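(* Let $q$ be a power of a prime $p$, and fix a finite set $\mathcal{K}=\{r_1,\ldots,r_k\}\subset \mathbb{N}$ with $(r_i,p)=1$ for every $1\leq i\leq k$. There exist constants $c>0$ and $A>0$, depending only on $\mathcal{K}$ and $q$, such that the following holds. Let $n\in \mathbb{N}$, let $\beta_1,\ldots,\beta_k\in\mathbb{T}$, let $1\le i\le k$, define \[ \Delta_i:=\operatorname{ord} \beta_i+r_in, \] and suppose that $\Delta_i<n/2$. Then \[ \Bigl|\sum_{\substack{f\in\mathbb{F}_q[t]\\ \deg f<n}}e(\beta_1f^{r_1}+\cdots+\beta_kf^{r_k})\Bigr| \le A\, q^{n-c\Delta_i}. \]
   Context: $\mathbb{N}$ is the set of positive integers; $\deg 0=-\infty$. Every nonzero $\alpha\in\mathbb{K}_\infty=\mathbb{F}_q((1/t))$ has a unique expansion $\alpha=\sum_{j\le J}a_jt^j$ with $a_j\in\mathbb{F}_q$, $a_J\ne0$; set $\operatorname{ord}\alpha:=J$ and $\operatorname{ord}0:=-\infty$ (so the bound is vacuous when $\beta_i=0$). $\mathbb{T}:=\{\sum_{j\le-1}a_jt^j:a_j\in\mathbb{F}_q\}=\{\alpha\in\mathbb{K}_\infty:\operatorname{ord}\alpha<0\}$. Let $\operatorname{res}\alpha:=a_{-1}$ (zero if no $t^{-1}$ term appears) and define the additive character $e(\alpha):=\exp\left(\frac{2\pi i}{p}\operatorname{Tr}_{\mathbb{F}_q/\mathbb{F}_p}(\operatorname{res}\alpha)\right)$ on $\mathbb{K}_\infty$. *)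

(* Defs.v *)
From HB Require Import structures.
From mathcomp Require Import all_boot all_order all_algebra all_field.
From mathcomp Require Import complex zify.
From mathcomp Require Import all_classical all_reals all_analysis.

Set Implicit Arguments.
Unset Strict Implicit.
Unset Printing Implicit Defensive.
Import Order.TTheory GRing.Theory Num.Theory.
Local Open Scope classical_set_scope.
Local Open Scope ring_scope.

(* [laurent F] is F((1/t)): [a : laurent F] stands for the formal series
   \sum_j a_j t^j, where a_j vanishes for all large enough j. *)
Record laurent (F : fieldType) := Laurent {
  lcoef :> int -> F;
  lcoef_bounded : exists J : int, forall j : int, J < j -> lcoef j = 0 }.

HB.instance Definition _ (F : fieldType) := gen_eqMixin (laurent F).
HB.instance Definition _ (F : fieldType) := gen_choiceMixin (laurent F).

Section LaurentRing.
Variable F : fieldType.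
Implicit Types (a b c : laurent F) (A B n : int).

Lemma laurentP a b : (forall j, a j = b j) -> a = b.
Proof.
case: a b => [a ha] [b hb] /= /funext eqab.
by case: _ / eqab hb => hb; congr Laurent; apply: Prop_irrelevance.
Qed.

Fact laurent0_subproof : exists J : int, forall j, J < j -> (0 : F) = 0.
Proof. by exists 0. Qed.
Definition laurent0 : laurent F := Laurent laurent0_subproof.

Fact laurentN_subproof a : exists J : int, forall j, J < j -> - a j = 0.
Proof. by case: (lcoef_bounded a) => J hJ; exists J => j /hJ ->; rewrite oppr0. Qed.
Definition laurentN a : laurent F := Laurent (laurentN_subproof a).

Lemma laurent_bound2 a b : exists J : int,
  (forall j, J < j -> a j = 0) /\ (forall j, J < j -> b j = 0).
Proof.
case: (lcoef_bounded a) (lcoef_bounded b) => [A hA] [B hB].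
by exists (Num.max A B); split=> j; rewrite gt_max => /andP[? ?]; auto.
Qed.

Fact laurentD_subproof a b : exists J : int, forall j, J < j -> a j + b j = 0.
Proof.
case: (laurent_bound2 a b) => J [hA hB].
by exists J => j Jj; rewrite hA// hB// addr0.
Qed.
Definition laurentD a b : laurent F := Laurent (laurentD_subproof a b).

Fact laurent_addA : associative laurentD.
Proof. by move=> a b c; apply: laurentP => j /=; rewrite addrA. Qed.
Fact laurent_addC : commutative laurentD.
Proof. by move=> a b; apply: laurentP => j /=; rewrite addrC. Qed.
Fact laurent_add0 : left_id laurent0 laurentD.
Proof. by move=> a; apply: laurentP => j /=; rewrite add0r. Qed.
Fact laurent_addN : left_inverse laurent0 laurentN laurentD.
Proof. by move=> a; apply: laurentP => j /=; rewrite addNr. Qed.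

HB.instance Definition _ := GRing.isZmodule.Build (laurent F)
  laurent_addA laurent_addC laurent_add0 laurent_addN.

(* The sum below has finite support. *)
Definition convol a b (n : int) : F := \sum_(i \in [set: int]) a i * b (n - i).

Lemma convolE a b A B (m : nat) :
  (forall j, A < j -> a j = 0) -> (forall j, B < j -> b j = 0) ->
  convol a b (A + B - m%:Z) =
    \sum_(l < m.+1) a (A - l%:Z) * b (B - (m - l)%N%:Z).
Proof.
move=> hA hB; rewrite /convol.
rewrite (fsbigE [seq A - l%:Z | l <- iota 0 m.+1]).
- rewrite big_map (_ : iota 0 m.+1 = index_iota 0 m.+1)//.
  rewrite big_mkord; apply: eq_big => [l|l _]; first by rewrite in_setT.
  by have lm := ltn_ord l; congr (_ * b _); lia.
- by rewrite map_inj_uniq ?iota_uniq// => x y; lia.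
- by [].
- move=> i _ imem.
  case: (ltP A i) => [/hA ->|iA]; first by rewrite mul0r.
  rewrite hB ?mulr0//; rewrite ltNge; apply: contra imem => h.
  by apply/mapP; exists (absz (A - i)%R); [rewrite mem_iota; lia|lia].
Qed.

Lemma convol0 a b A B n :
  (forall j, A < j -> a j = 0) -> (forall j, B < j -> b j = 0) ->
  A + B < n -> convol a b n = 0.
Proof.
move=> hA hB ltn; rewrite /convol fsbig1// => i _.
case: (ltP A i) => [/hA ->|iA]; first by rewrite mul0r.
by rewrite hB ?mulr0//; lia.
Qed.

Fact laurentM_subproof a b :
  exists J : int, forall j, J < j -> convol a b j = 0.
Proof.
case: (lcoef_bounded a) (lcoef_bounded b) => [A hA] [B hB].
by exists (A + B) => j; apply: convol0.
Qed.
Definition laurentM a b : laurent F := Laurent (laurentM_subproof a b).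

(* The first N coefficients of a below t^A, as a polynomial in 1/t. *)
Let trunc (N : nat) a A : {poly F} := \poly_(l < N) a (A - l%:Z).

Let convol_trunc (N : nat) a b A B (m : nat) :
  (forall j, A < j -> a j = 0) -> (forall j, B < j -> b j = 0) -> (m < N)%N ->
  convol a b (A + B - m%:Z) = (trunc N a A * trunc N b B)`_m.
Proof.
move=> hA hB mN; rewrite (convolE _ hA hB) coefM; apply: eq_bigr => l _.
have lm := ltn_ord l; rewrite !coef_poly.
by have -> : (l < N)%N by [lia]; have -> : (m - l < N)%N by [lia].
Qed.

Fact laurent_mulC : commutative laurentM.
Proof.
move=> a b; apply: laurentP => n /=.
case: (lcoef_bounded a) (lcoef_bounded b) => [A hA] [B hB].
case: (ltP (A + B) n) => h.
  by rewrite (convol0 hA hB)// (convol0 hB hA)// addrC.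
have -> : n = A + B - (absz (A + B - n)%R)%:Z by lia.
rewrite (convol_trunc hA hB (ltnSn _)) (addrC A).
by rewrite (convol_trunc hB hA (ltnSn _)) mulrC.
Qed.

Fact laurent_mulA : associative laurentM.
Proof.
move=> a b c; apply: laurentP => n /=.
case: (lcoef_bounded a) (lcoef_bounded b) => [A hA] [B hB].
case: (lcoef_bounded c) => [C hC].
have hAB j : A + B < j -> laurentM a b j = 0 by exact: convol0.
have hBC j : B + C < j -> laurentM b c j = 0 by exact: convol0.
case: (ltP (A + B + C) n) => h.
  by rewrite (convol0 hA hBC) ?addrA// (convol0 hAB hC).
have -> : n = A + B + C - (absz (A + B + C - n)%R)%:Z by lia.
set m := absz _; rewrite (convol_trunc hAB hC (ltnSn m)) -(addrA A).
rewrite (convol_trunc hA hBC (ltnSn m)).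
have coefE (x y : laurent F) (X Y : int) (hX : forall j, X < j -> x j = 0)
    (hY : forall j, Y < j -> y j = 0) (l : nat) : (l <= m)%N ->
    (trunc m.+1 (laurentM x y) (X + Y))`_l
    = (trunc m.+1 x X * trunc m.+1 y Y)`_l.
  by move=> lm; rewrite coef_poly ltnS lm /= (convol_trunc hX hY (N := m.+1)).
transitivity ((trunc m.+1 a A * trunc m.+1 b B * trunc m.+1 c C)`_m).
  rewrite -mulrA coefM [RHS]coefM; apply: eq_bigr => l _.
  by rewrite coefE// leq_subr.
rewrite coefM [RHS]coefM; apply: eq_bigr => l _.
by rewrite coefE// -ltnS.
Qed.

Fact laurent_mulDl : left_distributive laurentM laurentD.
Proof.
move=> a b c; apply: laurentP => n /=.
have [A [hA hB]] := laurent_bound2 a b.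
case: (lcoef_bounded c) => [C hC].
have hD j : A < j -> laurentD a b j = 0.
  by move=> Aj; rewrite /= hA// hB// addr0.
case: (ltP (A + C) n) => h.
  by rewrite (convol0 hD hC)// (convol0 hA hC)// (convol0 hB hC)// addr0.
have -> : n = A + C - (absz (A + C - n)%R)%:Z by lia.
rewrite (convolE _ hD hC) (convolE _ hA hC) (convolE _ hB hC) -big_split.
by apply: eq_bigr => l _; rewrite /= mulrDl.
Qed.

Definition poly_coef (f : {poly F}) (j : int) : F :=
  if j is Posz i then f`_i else 0.

Fact poly_laurent_subproof (f : {poly F}) :
  exists J : int, forall j, J < j -> poly_coef f j = 0.
Proof.
exists (size f)%:Z => -[i|i] //= h; rewrite nth_default//; lia.
Qed.
(* The inclusion of F[t] in F((1/t)). *)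
Definition poly_laurent (f : {poly F}) : laurent F :=
  Laurent (poly_laurent_subproof f).

Fact laurent_mul1 : left_id (poly_laurent 1) laurentM.
Proof.
move=> a; apply: laurentP => n /=; rewrite /convol.
rewrite (fsbigE [:: 0 : int])//.
  by rewrite big_mkcond big_seq1 in_setT/= coef1 mul1r subr0.
by move=> -[[|i]|i] _ //= _; rewrite ?coef1 mul0r.
Qed.

Fact laurent_one_neq0 : poly_laurent 1 != 0.
Proof.
apply/eqP => /(congr1 (fun a : laurent F => a 0)) /= /eqP.
by rewrite coef1 oner_eq0.
Qed.

HB.instance Definition _ := GRing.Zmodule_isComNzRing.Build (laurent F)
  laurent_mulA laurent_mulC laurent_mul1 laurent_mulDl laurent_one_neq0.

Fact poly_laurent_is_zmod_morphism : zmod_morphism poly_laurent.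
Proof.
by move=> f g; apply: laurentP => -[j|j] /=; rewrite ?coefB// subr0.
Qed.
HB.instance Definition _ := GRing.isZmodMorphism.Build {poly F} (laurent F)
  poly_laurent poly_laurent_is_zmod_morphism.

Fact poly_laurent_is_monoid_morphism : monoid_morphism poly_laurent.
Proof.
split=> // f g; apply: laurentP => -[m|m] /=.
  rewrite /convol (fsbigE [seq i%:Z | i <- iota 0 m.+1])//.
  - rewrite big_map (_ : iota 0 m.+1 = index_iota 0 m.+1)// big_mkord coefM.
    apply: eq_big => [l|l _]; first by rewrite in_setT.
    have lm := ltn_ord l; rewrite (_ : m%:Z - l%:Z = (m - l)%N%:Z)//; lia.
  - by rewrite map_inj_uniq ?iota_uniq// => x y [].
  - move=> -[i|i] _ imem; last by rewrite /= mul0r.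
    have im : (m < i)%N.
      rewrite ltnNge; apply: contra imem => im; apply/mapP; exists i => //.
      by rewrite mem_iota; lia.
    by rewrite (_ : m%:Z - i%:Z = Negz (i - m).-1) ?mulr0//; lia.
rewrite /convol fsbig1// => -[i|i] _ /=; last by rewrite mul0r.
by rewrite (_ : Negz m - i%:Z = Negz (m + i)) ?mulr0//; lia.
Qed.
HB.instance Definition _ := GRing.isMonoidMorphism.Build {poly F} (laurent F)
  poly_laurent poly_laurent_is_monoid_morphism.

Lemma lead_ex a : a != 0 -> exists J : int, a J != 0 /\ forall j, J < j -> a j = 0.
Proof.
move=> a0; have [i ai] : exists i, a i != 0.
  apply: contrapT => /forallNP h; move/eqP: a0; apply; apply: laurentP => j.
  by apply/eqP; apply: contrapT => /negP; exact: h.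
have [J hJ] := lcoef_bounded a.
have iJ : i <= J by rewrite leNgt; apply: contra ai => /hJ ->.
have ex : exists n : nat, a (J - n%:Z) != 0.
  by exists (absz (J - i)%R); rewrite (_ : J - _ = i)//; lia.
case: (ex_minnP ex) => n an nmin; exists (J - n%:Z); split=> // j nj.
apply/eqP/negPn/negP => aj.
have jJ : j <= J by rewrite leNgt; apply: contra aj => /hJ ->.
have /nmin : a (J - (absz (J - j)%R)%:Z) != 0 by rewrite (_ : J - _ = j)//; lia.
lia.
Qed.

Definition ord a : \bar int :=
  if a == 0 then -oo%E
  else (xget 0 [set J : int | a J != 0 /\ forall j, J < j -> a j = 0])%:E.

Lemma ord_laurent0 : ord 0 = -oo%E.
Proof. by rewrite /ord eqxx. Qed.

Lemma ord_laurentE a J : a J != 0 -> (forall j, J < j -> a j = 0) -> ord a = J%:E.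
Proof.
move=> aJ hJ; rewrite /ord; case: eqP => [a0|/eqP a0].
  by move: aJ; rewrite a0 eqxx.
case: xgetP => [K _ [aK hK]|/(_ J)]; last by case.
congr _%:E; apply/eqP; rewrite eq_le !leNgt; apply/andP; split; apply/negP.
  by move=> /hJ K0; rewrite K0 eqxx in aK.
by move=> /hK J0; rewrite J0 eqxx in aJ.
Qed.

Definition unitT : set (laurent F) := [set a | (ord a < 0)%E].

Definition res a : F := a (- 1).

End LaurentRing.

(* The trace from F to its prime field, as an element of 'F_p. *)
Definition trFp (p : nat) (F : finFieldType) (charF : p \in [pchar F]) (x : F) :
    'F_p :=
  let L := pPrimeCharType charF in
  odflt 0 [pick u : 'F_p | u%:A == galTrace 1 {:L} x].

Lemma trFpE (p : nat) (F : finFieldType) (charF : p \in [pchar F])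
    (L := pPrimeCharType charF) (x : L) :
  (trFp charF x)%:A = galTrace 1 {:L} x.
Proof.
rewrite /trFp; case: pickP => [u /eqP//|h].
have /vlineP[u uE] : galTrace 1 {:L} x \in 1%VS.
  by apply: mem_galTrace; [exact: finField_galois (subvf _)|exact: memvf].
by have := h u; rewrite uE eqxx.
Qed.

(* The argument of the exponential does not depend, modulo 2 pi i, on the
   representative in nat of the trace. *)
Definition echar (R : realType) (p : nat) (F : finFieldType)
    (charF : p \in [pchar F]) (a : laurent F) : R[i] :=
  let theta : R := 2 * pi / p%:R * (trFp charF (res a) : nat)%:R in
  (cos theta +i* sin theta)%C.

(* x ^ y for an extended real y; the values at infinity assume x > 1. *)
Definition epow (R : realType) (x : R) (y : \bar R) : \bar R :=
  match y with
  | y%:E => (x `^ y)%:E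
  | +oo%E => +oo%E
  | -oo%E => 0%E
  end.

(* Main.v *)
Require Import Defs.
From HB Require Import structures.
From mathcomp Require Import all_boot all_order all_algebra all_field.
From mathcomp Require Import complex zify ring.
From mathcomp Require Import all_fingroup pgroup.
From mathcomp Require Import all_classical all_reals all_analysis.

Set Implicit Arguments.
Unset Strict Implicit.
Unset Printing Implicit Defensive.
Import Order.TTheory GRing.Theory Num.Theory.
Local Open Scope ring_scope.

(** Suppose that the sum over the f of degree less than n has absolute value at
least q^(n-E), with E >= 0. The heart of the matter is that every coefficient
beta_j is then close to a rational function with a small denominator: there is a
nonzero polynomial B_j of degree O(E+1) such that the fractional part of
B_j beta_j has order at most O(E+1) - r_j n (lemma [coefficient_approximation]).
Take for E the integer part of c Delta, with c small, where
ord beta_i = Delta - r_i n and 0 < Delta < n/2. Then B_i beta_i has negative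
order, so that it is its own fractional part, and its order is at least
Delta - r_i n, more than the approximation allows unless Delta is bounded.

The approximation comes from Weyl differencing, but over F_p instead of F_q[t]:
if r has the base p digits of a word a_1 ... a_D, then f^r is the product of the
D additive maps f |-> f^(p^a_i), so that differencing D times, where D is the
digit sum of r, leaves a form which is additive in each of D variables, and no
factorial of r appears. Among the exponents that are present, those with the
largest digit sum D survive, and the form is a sum of monomials
beta_j prod_i h_i^(p^b_i), where b runs through the rearrangements of the digits
of r_j. The monomial that belongs to one given arrangement is counted as many
times as there are permutations that fix the word, and this number is prime to p
since no digit reaches p ([stabilizer_coprime]). If the sum is large, then for
many h_1, ..., h_(D-1) the form is a trivial character of its last variable y.

Two more ideas extract one coefficient from this form. First, multiplying h_i by
t^(p^c) or y by t^(p^d) multiplies a monomial by t^(p^(c+b_i)) or by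
t^(p^(d+b_l)), where l is the place of y, so the difference of both operations
kills the monomials with b_i - b_l = d - c ([term_sum_separator]). These
differences of letters determine b: they do so up to a common shift, and each
r_j is prime to p, so that its word contains the letter 0. Hence a bounded
number of such steps leaves one monomial, with y to the first power. Secondly,
for a fixed alpha the h for which alpha h^(p^a) has a small fractional part form
a group, and if this group has index at most q^E, then it contains a nonzero
element b of degree at most E, and b^(p^a) alpha has a much smaller fractional
part ([rational_approximation]). This removes the variables one by one, the most
frequent b being chosen each time ([eliminate_variables]).

Once beta_j is approximated, f runs through a progression x0 + B z on which
beta_j f^(r_j) does not change the character, and the argument is repeated
without the exponent r_j ([remove_exponent]). *)

(** * Fractional parts in F((1/t)) *)

Section Small.
Variable F : fieldType.
Implicit Types (a b : laurent F) (y : {poly F}).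

(** The fractional part of a has order less than -N: the indices Negz i, with
i < N, are the exponents -1, ..., -N. *)
Definition small (N : nat) a : Prop := forall i : nat, (i < N)%N -> a (Negz i) = 0.

Lemma smallW N M a : (M <= N)%N -> small N a -> small M a.
Proof. by move=> MN sa i iM; apply: sa; apply: leq_trans MN. Qed.

Lemma coef_polyM y a (n : int) :
  (poly_laurent y * a) n = \sum_(i < size y) y`_i * a (n - i%:Z).
Proof.
rewrite [LHS]/= /convol (fsbigE [seq i%:Z | i <- iota 0 (size y)])//.
- rewrite big_map (_ : iota 0 _ = index_iota 0 (size y)); last first.
    by rewrite /index_iota subn0.
  by rewrite big_mkord; apply: eq_big => [i|i _] //; rewrite in_setT.
- by rewrite map_inj_uniq ?iota_uniq// => i j [].
- move=> -[i|i] _ imem; last by rewrite /= mul0r.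
  rewrite /= nth_default ?mul0r// leqNgt; apply: contra imem => im.
  by apply/mapP; exists i; rewrite ?mem_iota.
Qed.

Lemma small_polyM N d y a :
  (size y <= d.+1)%N -> small N a -> small (N - d) (poly_laurent y * a).
Proof.
move=> yd sa i iN; rewrite coef_polyM big1// => j _; have jy := ltn_ord j.
rewrite (_ : Negz i - j%:Z = Negz (i + j)); last by lia.
by rewrite sa ?mulr0//; lia.
Qed.

(** The polynomial part of a contributes only to the exponents from 0 on, so that the
first terms of y and of the fractional part of a meet alone. *)
Lemma coef_lead_polyM N y a : small N a -> ((size y).-1 <= N)%N ->
  (poly_laurent y * a) (Negz (N - (size y).-1)) = lead_coef y * a (Negz N).
Proof.
move=> sa; rewrite coef_polyM lead_coefE; case sy: (size y) => [|d] /= dN.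
  by rewrite big_ord0 nth_default ?mul0r// sy.
rewrite big_ord_recr big1 /= ?add0r => [|j _].
  by congr (_ * a _); lia.
have jd := ltn_ord j; rewrite (_ : _ - _ = Negz (N - d + j)); last by lia.
by rewrite sa ?mulr0//; lia.
Qed.

End Small.

(** * The additive character *)

Section Character.
Variables (p : nat) (F : finFieldType) (charF : p \in [pchar F]).
Implicit Types (a b : laurent F).

Local Notation L := (pPrimeCharType charF).

(** The exponent of the character: echar a is the power psi a of a primitive p-th
root of unity. *)
Definition psi a : 'F_p := trFp charF (res a).

Lemma trFpD (x y : F) : trFp charF (x + y) = trFp charF x + trFp charF y.
Proof.
have inj : injective (fun u : 'F_p => u%:A : L) by exact: (fmorph_inj (in_alg L)).
by apply: inj; rewrite scalerDl !trFpE -raddfD.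
Qed.

Lemma psiD a b : psi (a + b) = psi a + psi b.
Proof. exact: trFpD. Qed.

Lemma psi0 : psi 0 = 0.
Proof. by apply: (addrI (psi 0)); rewrite -psiD !addr0. Qed.

Lemma psiN a : psi (- a) = - psi a.
Proof. by apply/eqP; rewrite -addr_eq0 -psiD addNr psi0. Qed.

Lemma psiB a b : psi (a - b) = psi a - psi b.
Proof. by rewrite psiD psiN. Qed.

(** The trace is a sum of distinct automorphisms, and these are independent. *)
Lemma trFp_nondegenerate (x : F) : (forall z, trFp charF (z * x) = 0) -> x = 0.
Proof.
move=> tr0; apply/eqP/negP => /negP x0.
have trG (z : L) : z \in {:L}%VS -> \sum_(s in ('Gal({:L} / 1))%g) 1 * s z = 0 :> L.
  move=> _; rewrite (eq_bigr (fun s : gal_of {:L} => s z)) => [|s _]; last exact: mul1r.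
  rewrite -[LHS]/(galTrace 1 {:L} z) -trFpE -[z](mulfVK x0) tr0.
  exact: scale0r.
by have /eqP := gal_independent trG (group1 _); rewrite oner_eq0.
Qed.

Lemma psi_nondegenerate (M : nat) a :
    (forall y : {poly F}, (size y <= M)%N -> psi (poly_laurent y * a) = 0) ->
  small M a.
Proof.
move=> psi_a i iM; apply: trFp_nondegenerate => z.
have sz : (size (z *: 'X^i : {poly F}) <= i.+1)%N.
  by apply: leq_trans (size_scale_leq _ _) _; rewrite size_polyXn.
rewrite -(psi_a (z *: 'X^i)); last by apply: leq_trans sz iM.
congr trFp; rewrite /res coef_polyM.
have [->|z0] := eqVneq z 0; first by rewrite scale0r size_poly0 big_ord0 mul0r.
rewrite size_scale // size_polyXn big_ord_recr big1 /= ?add0r => [|j _].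
  by rewrite coefZ coefXn eqxx mulr1; congr (_ * a _); lia.
by rewrite coefZ coefXn ltn_eqF ?mulr0 ?mul0r.
Qed.

Variable R : realType.
Local Notation e := (echar R charF).
Local Open Scope complex_scope.

Let cis (x : R) : R[i] := cos x +i* sin x.

Let cisD x y : cis (x + y) = cis x * cis y.
Proof. by rewrite /cis cosD sinD; simpc; congr (_ +i* _); rewrite addrC. Qed.

Let cisMn x n : cis (x * n%:R) = cis x ^+ n.
Proof.
elim: n => [|n IHn]; first by rewrite mulr0 /cis cos0 sin0.
by rewrite -natr1 mulrDr mulr1 cisD IHn exprSr.
Qed.

Let p_prime : prime p. Proof. by case/andP: charF. Qed.

Let theta : R := 2 * pi / p%:R.

Let thetap : theta * p%:R = pi *+ 2.
Proof. by rewrite /theta divfK ?mulr_natl// pnatr_eq0; case: p p_prime. Qed.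

Let echarE a : e a = cis theta ^+ psi a.
Proof. by rewrite -cisMn. Qed.

Let cis_thetap : cis theta ^+ p = 1.
Proof. by rewrite -cisMn thetap /cis cos2pi sin2pi. Qed.

Lemma echarD a b : e (a + b) = e a * e b.
Proof.
rewrite !echarE psiD -exprD /= [X in (_ %% X)%N]Fp_cast//.
by rewrite -[in RHS](expr_mod _ cis_thetap).
Qed.

Lemma echar0 : e 0 = 1.
Proof. by rewrite echarE psi0. Qed.

Lemma echar_norm a : `|e a| = 1.
Proof.
by rewrite normc_def /echar /= cos2Dsin2 sqrtr1.
Qed.

Lemma echar_eq1 a : e a = 1 -> psi a = 0.
Proof.
have := ltn_ord (psi a); rewrite [X in (_ < X)%N]Fp_cast// => psi_p.
move=> /(congr1 (@complex.Re R)) /=; rewrite -/theta -/(psi a) => cos1.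
apply/eqP/negP => /negP psi0; have {}psi0 : (0 < psi a)%N.
  by rewrite lt0n; apply: contra psi0 => /eqP psi0; apply/eqP/val_inj.
pose x : R := theta * (psi a)%:R / 2.
have p0 : 0 < p%:R :> R by rewrite ltr0n prime_gt0.
have theta0 : 0 < theta by rewrite divr_gt0// mulr_gt0// pi_gt0.
have x0 : 0 < x < pi.
  apply/andP; split; first by rewrite /x divr_gt0// mulr_gt0// ltr0n.
  rewrite /x ltr_pdivrMr// [pi * 2]mulr_natr -thetap.
  by rewrite ltr_pM2l// ltr_nat.
have sx := sin_gt0_pi x0.
have xx : theta * (psi a)%:R = x + x by exact: splitr.
move: cos1; rewrite xx cosD -!expr2 cos2sin2 => /eqP.
rewrite -addrA -opprD subr_eq addrC -subr_eq subrr eq_sym -mulr2n mulrn_eq0 /=.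
by rewrite sqrf_eq0 gt_eqF.
Qed.

End Character.

(** * Counting tuples *)

Section Update.
Variables (I V : finType).
Implicit Types (h : {ffun I -> V}) (j : I) (v : V).

Definition upd h j v : {ffun I -> V} := [ffun i => if i == j then v else h i].

Lemma upd_same h j v : upd h j v j = v.
Proof. by rewrite ffunE eqxx. Qed.

Lemma upd_other h j v i : i != j -> upd h j v i = h i.
Proof. by rewrite ffunE => /negbTE ->. Qed.

Lemma upd_id h j : upd h j (h j) = h.
Proof. by apply/ffunP => i; rewrite ffunE; case: eqP => [->|]. Qed.

Lemma upd_upd h j v v' : upd (upd h j v) j v' = upd h j v'.
Proof. by apply/ffunP => i; rewrite !ffunE; case: eqP. Qed.

(** Exchanging v with the old value at j is an involution on the pairs (h, v). This
is how properties of one variable, the others being fixed, give densities in the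
set of all tuples. *)
Lemma sum_upd (M : nmodType) j (f : {ffun I -> V} -> M) :
  \sum_h \sum_v f (upd h j v) = (\sum_h f h) *+ #|V|.
Proof.
rewrite pair_big /=.
pose g (hv : {ffun I -> V} * V) := (upd hv.1 j hv.2, hv.1 j).
have gK : involutive g.
  by move=> [h v]; rewrite /g /= upd_upd upd_same upd_id.
rewrite (reindex_inj (inv_inj gK)) /=.
transitivity (\sum_(hv : {ffun I -> V} * V) f hv.1).
  by apply: eq_bigr => -[h v] _; rewrite /= upd_upd upd_id.
rewrite -(pair_bigA _ (fun h _ => f h)) /= -sumrMnl.
by apply: eq_bigr => h _; rewrite sumr_const.
Qed.

Lemma card_upd j (G : {set {ffun I -> V}}) :
  (\sum_h #|[set v | upd h j v \in G]| = #|V| * #|G|)%N.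
Proof.
have -> : #|G| = (\sum_h (h \in G))%N by rewrite -sum1_card big_mkcond.
transitivity (\sum_h \sum_v ((upd h j v \in G) : nat))%R.
  apply: eq_bigr => h _; rewrite -sum1_card big_mkcond /=.
  by apply: eq_bigr => v _; rewrite inE; case: (_ \in G).
by rewrite (sum_upd j (fun h => (h \in G) : nat)) -mulr_natl natn.
Qed.

End Update.

Lemma sqr_sum_le (R : numDomainType) (I : finType) (a : I -> R) :
  (forall i, 0 <= a i) -> (\sum_i a i) ^+ 2 <= #|I|%:R * \sum_i a i ^+ 2.
Proof.
move=> a0; rewrite -subr_ge0 -(pmulrn_lge0 _ (ltn0Sn 1)).
have -> : (#|I|%:R * (\sum_i a i ^+ 2) - (\sum_i a i) ^+ 2) *+ 2
    = \sum_i \sum_j (a i - a j) ^+ 2.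
  have row i : \sum_j (a i - a j) ^+ 2
      = a i ^+ 2 *+ #|I| + \sum_j a j ^+ 2 - (a i * \sum_j a j) *+ 2.
    rewrite mulr_sumr -sumrMnl -sumr_const -big_split -sumrB /=.
    by apply: eq_bigr => j _; rewrite sqrrB addrAC.
  under [RHS]eq_bigr do rewrite row.
  rewrite sumrB big_split /= sumr_const !sumrMnl -mulr_suml -expr2.
  by rewrite mulrnBl mulr2n mulr_natl.
apply: sumr_ge0 => i _; apply: sumr_ge0 => j _.
by apply: real_exprn_even_ge0 => //; rewrite realB// ger0_real.
Qed.

Lemma sqr_sum_leq (I : finType) (a : I -> nat) :
  ((\sum_i a i) ^ 2 <= #|I| * \sum_i a i ^ 2)%N.
Proof.
have := @sqr_sum_le int I (fun i => (a i)%:R) (fun i => ler0n _ _).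
rewrite -natr_sum -natrX; under [in X in _ <= X]eq_bigr do rewrite -natrX.
by rewrite -natr_sum -natrM ler_nat.
Qed.

(** * Weyl differencing *)

Section Weyl.
Variables (I : finType) (V : finZmodType) (C : numClosedFieldType).
Implicit Types (h : {ffun I -> V}) (s : seq I) (f : V -> C).

Fixpoint mdiff s h f : V -> C :=
  if s is j :: s' then fun x => mdiff s' h f (x + h j) * (mdiff s' h f x)^*
  else f.

Lemma mdiff_upd s h j v f x : j \notin s -> mdiff s (upd h j v) f x = mdiff s h f x.
Proof.
elim: s x => //= i s IHs x; rewrite inE negb_or eq_sym => /andP[ij js].
by rewrite !IHs// upd_other.
Qed.

(** Averaging over the tuples h indexed by all of I, and not by s, keeps the set of
tuples the same when s grows: the step for j is an average over the entry at j. *)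
Lemma weyl_differencing s f : uniq s ->
  `|\sum_x f x| ^+ (2 ^ size s) * (#|V| ^ #|I|)%:R
    <= (#|V| ^ (2 ^ size s).-1)%:R * \sum_h `|\sum_x mdiff s h f x|.
Proof.
elim: s => [_|j s IHs /= /andP[js us]] /=.
  by rewrite expr1 expn0 mul1r sumr_const card_ffun mulr_natr.
set N := #|V|; set T := #|I|; set A := `|\sum_x f x|; set k := size s.
have N0 : 0 < N%:R :> C by rewrite ltr0n; apply/card_gt0P; exists 0.
have T0 : 0 < (N ^ T)%:R :> C by rewrite natrX exprn_gt0.
rewrite -(ler_pM2r T0) expnS mul2n -addnn exprD.
rewrite [X in X <= _](_ : _ = (A ^+ (2 ^ k) * (N ^ T)%:R) ^+ 2); last first.
  by rewrite expr2 mulrACA mulrA.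
have {IHs us} := IHs us; rewrite -/A -/N -/T -/k => IH.
apply: le_trans (_ : _ <= ((N ^ (2 ^ k).-1)%:R * \sum_h `|\sum_x mdiff s h f x|) ^+ 2) _.
  rewrite lerXn2r// nnegrE mulr_ge0 ?exprn_ge0 ?ler0n ?normr_ge0//.
  by rewrite sumr_ge0.
have CS := sqr_sum_le (fun h => normr_ge0 (\sum_x mdiff s h f x)).
rewrite exprMn -natrX; apply: (le_trans (ler_wpM2l (ler0n _ _) CS)).
rewrite card_ffun -/N -/T; set Z := \sum_h `|_|.
have -> : (2 ^ k + 2 ^ k).-1 = ((2 ^ k).-1 * 2).+1.
  by have := expn_gt0 2 k; lia.
rewrite [X in _ <= X](_ : _ = ((N ^ (2 ^ k).-1) ^ 2)%:R * ((N ^ T)%:R * (Z *+ N))).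
  rewrite ler_wpM2l ?ler0n// ler_wpM2l ?ler0n//.
  rewrite -(sum_upd j); apply: ler_sum => h _.
  rewrite -[X in X <= _]ger0_norm ?exprn_ge0// normCK rmorph_sum mulr_suml.
  under eq_bigr do rewrite mulr_sumr.
  rewrite exchange_big /=.
  have -> : \sum_x \sum_y mdiff s h f y * (mdiff s h f x)^*
     = \sum_v \sum_x mdiff s h f (x + v) * (mdiff s h f x)^*.
    rewrite [RHS]exchange_big; apply: eq_bigr => x _.
    by rewrite (reindex_inj (addrI x)).
  apply: le_trans (ler_norm_sum _ _ _) _.
  apply: ler_sum => v _; rewrite le_eqVlt; apply/orP; left; apply/eqP.
  by congr `|_|; apply: eq_bigr => x _; rewrite !mdiff_upd// upd_same.
by rewrite expnS expnM natrM -mulr_natl; ring.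
Qed.

End Weyl.


(** * Differences of products of additive maps *)

Section Polarization.
Variables (I : finType) (K : comNzRingType).

(** Adding and removing i pairs off the supersets of T with opposite signs. *)
Lemma sum_sign_supersets (T : {set I}) i : i \notin T ->
  \sum_(S : {set I} | T \subset S) (-1) ^+ #|S| = 0 :> K.
Proof.
move=> iT; rewrite (bigID (fun S : {set I} => i \in S)) /=.
rewrite (reindex_onto (fun S => i |: S)%SET (fun S => S :\ i)%SET) /=; last first.
  by move=> S /andP[_ iS]; rewrite finset.setD1K.
rewrite (eq_bigl (fun S : {set I} => (T \subset S) && (i \notin S))) => [|S].
  rewrite -big_split big1 //= => S /andP[_ iS].
  by rewrite cardsU1 iS add1n exprS mulN1r addNr.
rewrite !inE eqxx /= andbT; apply/andP/andP => [[/fintype.subsetP TS /eqP SE]|[TS iS]].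
  split; last by rewrite -SE !inE eqxx.
  apply/fintype.subsetP => j jT; move: (TS j jT); rewrite !inE.
  by case: eqP => // ji; rewrite -ji jT in iT.
by rewrite finset.setU1K// eqxx (fintype.subset_trans TS)// finset.subsetU1.
Qed.

Section Ryser.
Variables (J : finType) (z : J -> K) (y : J -> I -> K).

(** The product of the rows z j + y j 1 + y j 2 + ... expands along the functions
that choose in each row j the constant (left summand) or a column i (right
summand). *)
Definition entry (j : J) (o : 'I_1 + I) : K := if o is inr i then y j i else z j.

Definition columns (f : {ffun J -> 'I_1 + I}) : {set I} := [set i | inr i \in codom f]%SET.

Lemma sum_sign_prod :
  \sum_(S : {set I}) (-1) ^+ #|S| * \prod_j (z j + \sum_(i in S) y j i)
  = (-1) ^+ #|I| * \sum_(f | columns f == finset.setTfor I) \prod_j entry j (f j).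
Proof.
have expand (S : {set I}) : \prod_j (z j + \sum_(i in S) y j i)
    = \sum_(f : {ffun J -> 'I_1 + I} | columns f \subset S) \prod_j entry j (f j).
  rewrite [RHS]big_mkcond /=.
  pose G j (o : 'I_1 + I) :=
    if o is inr i then (if i \in S then y j i else 0) else z j.
  have -> : \prod_j (z j + \sum_(i in S) y j i) = \prod_j \sum_o G j o.
    by apply: eq_bigr => j _; rewrite big_sumType big_ord1 -big_mkcond.
  rewrite bigA_distr_bigA; apply: eq_bigr => f _; case: ifPn => [fS|].
    apply: eq_bigr => j _; rewrite /G /entry; case fj: (f j) => [//|i].
    rewrite (fintype.subsetP fS)// inE -fj; exact: codom_f.
  case/fintype.subsetPn => i; rewrite inE => /codomP[j fj] iS.
  by rewrite (bigD1 j)//= /G -fj (negbTE iS) mul0r.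
under eq_bigr do rewrite expand mulr_sumr.
rewrite (exchange_big_dep xpredT)//= mulr_sumr [RHS]big_mkcond.
apply: eq_bigr => f _; rewrite -mulr_suml.
case: eqP => [->|/eqP fT].
  congr (_ * _); rewrite (big_pred1 (finset.setTfor I)) ?cardsT// => S.
  by rewrite finset.subTset.
have [i ifT] : exists i, i \notin columns f.
  apply/existsP; apply: contraR fT => /existsPn fT.
  apply/eqP/setP => i; rewrite [RHS]inE.
  by have := fT i; rewrite negbK => ->.
by rewrite (sum_sign_supersets ifT) mul0r.
Qed.

Lemma ryser_lt : (#|J| < #|I|)%N ->
  \sum_(S : {set I}) (-1) ^+ #|S| * \prod_j (z j + \sum_(i in S) y j i) = 0.
Proof.
move=> JI; rewrite sum_sign_prod big1 ?mulr0// => f /eqP fT.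
suff : (#|I| <= #|J|)%N by rewrite leqNgt JI.
rewrite -cardsT -fT.
pose column (o : 'I_1 + I) := if o is inr i then Some i else None.
have -> : columns f = [set i in pmap column (codom f)]%SET.
  apply/setP => i; rewrite !inE mem_pmap; apply/idP/mapP => [fi|[[//|j] fj [->]]//].
  by exists (inr i).
rewrite cardsE; apply: leq_trans (card_size _) _; rewrite size_pmap.
by apply: leq_trans (count_size _ _) _; rewrite size_codom.
Qed.

End Ryser.

(** Ryser's formula for the permanent; the constants z cancel. In the uses below, z
holds the base point of the difference, and the y the shifts. *)
Lemma ryser_eq (z : I -> K) (y : I -> I -> K) :
  \sum_(S : {set I}) (-1) ^+ #|S| * \prod_j (z j + \sum_(i in S) y j i)
  = (-1) ^+ #|I| * \sum_(s : {perm I}) \prod_i y (s i) i.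
Proof.
rewrite sum_sign_prod; congr (_ * _).
pose P (s : {perm I}) : {ffun I -> 'I_1 + I} := [ffun j => inr (s^-1%g j)].
have PJ : injective P.
  move=> s s' /ffunP ss; apply: invg_inj; apply/permP => j.
  by have := ss j; rewrite !ffunE => -[].
rewrite (eq_bigl [in [set P s | s in {perm I}]%SET]) => [|f].
  rewrite big_imset /=; last by move=> s s' _ _; exact: PJ.
  apply: eq_big => // s _; rewrite (reindex_inj (@perm_inj _ s)) /=.
  by apply: eq_bigr => i _; rewrite ffunE permK.
apply/eqP/imsetP => [fT|[s _ ->]]; last first.
  apply/setP => i; rewrite !inE; apply/codomP; exists (s i).
  by rewrite ffunE permK.
have /all_sig[k fk] i : {j | f j = inr i}.
  have /codomP/sig_eqW[j ->] : inr i \in codom f; last by exists j.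
  have : i \in columns f by rewrite fT finset.in_setT.
  by rewrite inE.
have k_inj : injective k by move=> i j kij; have := fk i; rewrite kij fk => -[].
exists (perm k_inj) => //; apply/ffunP => j.
by rewrite ffunE -{1}[j](permKV (perm k_inj)) permE fk.
Qed.

End Polarization.

Section AdditiveDifferences.
Variables (I : finType) (V : zmodType).
Implicit Types (h : I -> V) (s : seq I).

Fixpoint adiff (K : zmodType) s h (f : V -> K) : V -> K :=
  if s is j :: s' then fun x => adiff s' h f (x + h j) - adiff s' h f x else f.

Lemma adiff_sum (K : zmodType) (J : finType) (P : pred J) s h (f : J -> V -> K) x :
  adiff s h (fun x => \sum_(j | P j) f j x) x = \sum_(j | P j) adiff s h (f j) x.
Proof. by elim: s x => //= j s IHs x; rewrite !IHs sumrB. Qed.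

(** An iterated difference is an alternating sum over the vertices of a cube. *)
Lemma adiff_cube (K : comNzRingType) s h (f : V -> K) x : uniq s ->
  adiff s h f x = (-1) ^+ size s *
    \sum_(S : {set I} | [forall i in S, i \in s])
      (-1) ^+ #|S| * f (x + \sum_(i in S) h i).
Proof.
elim: s x => [|j s IHs] x /= => [_|/andP[js us]].
  rewrite (big_pred1 finset.set0) ?cards0 ?expr0 ?mul1r ?big_set0 ?addr0//.
  move=> S; apply/forall_inP/eqP => [S0|-> i]; last by rewrite inE.
  by apply/setP => i; rewrite !inE; apply/negP => /S0.
rewrite !IHs// -mulrBr exprSr -mulrA mulN1r; congr (_ * _).
rewrite [in RHS](bigID (fun S : {set I} => j \in S)) /= opprD; congr (_ - _).
  rewrite -sumrN.
  rewrite [RHS](reindex_onto (fun S => j |: S)%SET (fun S => S :\ j)%SET) /=; last first.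
    by move=> S /andP[_ jS]; rewrite finset.setD1K.
  apply: eq_big => [S|S /forall_inP Ss].
    apply/forall_inP/andP => [Ss|[/andP[/forall_inP Ss jS] /eqP SE] i iS].
      have jS : j \notin S by apply/negP => /Ss jn; rewrite jn in js.
      split; last by rewrite finset.setU1K.
      rewrite !inE eqxx andbT; apply/forall_inP => i; rewrite !inE.
      by case/orP => [->//|/Ss ->]; rewrite orbT.
    have := Ss i; rewrite !inE iS orbT => /(_ isT); case/orP => // /eqP ij.
    by rewrite -SE ij !inE eqxx in iS.
  have jS : j \notin S by apply/negP => /Ss jn; rewrite jn in js.
  by rewrite cardsU1 jS add1n exprS mulN1r mulNr opprK big_setU1//= addrA.
apply: eq_bigl => S; apply/forall_inP/andP => [Ss|[/forall_inP Ss jS] i iS].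
  split; last by apply/negP => /Ss jn; rewrite jn in js.
  by apply/forall_inP => i /Ss; rewrite inE => ->; rewrite orbT.
have := Ss i iS; rewrite inE => /orP[/eqP ij|//].
by rewrite -ij iS in jS.
Qed.

Lemma adiff_full (K : comNzRingType) s h (f : V -> K) x : uniq s -> s =i I ->
  adiff s h f x = (-1) ^+ #|I| *
    \sum_(S : {set I}) (-1) ^+ #|S| * f (x + \sum_(i in S) h i).
Proof.
move=> us sI; rewrite adiff_cube//; congr (_ * _).
  by rewrite -(card_uniqP us) (eq_card sI).
by apply: eq_bigl => S; apply/forall_inP => i _; rewrite sI.
Qed.

End AdditiveDifferences.

(** * Rational approximation from many small multiples *)

Lemma pigeonhole_cover (T U : finType) (A : {set T}) (B : U -> {set T}) (u0 : U) :
  (forall x, x \in A -> exists u, x \in B u) -> exists u, (#|A| <= #|B u| * #|U|)%N.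
Proof.
move=> AB; pose u := [arg max_(u > u0) #|B u|]; exists u.
have Bu v : (#|B v| <= #|B u|)%N by rewrite /u; case: arg_maxnP => // w _; exact.
apply: (@leq_trans (\sum_v #|B v|)); last first.
  by rewrite mulnC -sum_nat_const leq_sum.
rewrite -sum1_card (eq_bigr (fun v => \sum_(x in B v) 1)%N) => [|v _]; last first.
  by rewrite sum1_card.
rewrite (exchange_big_dep xpredT)//= big_mkcond leq_sum// => x _.
by case: ifP => // /AB[v xv]; rewrite (bigD1 v).
Qed.

Section Window.
Variable F : finFieldType.
Local Notation q := #|F|.

Lemma card_field_gt1 : (1 < q)%N. Proof. exact: finNzRing_gt1. Qed.

Lemma size_polyX_exp (x : {poly F}) k d : (size x <= d.+1)%N ->
  (size (x ^+ k) <= (k * d).+1)%N.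
Proof.
move=> xd; apply: leq_trans (size_poly_exp_leq _ _) _.
by rewrite ltnS mulnC leq_mul2l; apply/orP; right; lia.
Qed.

(** H has index at most q^E, so it meets the space of the multiples X^u w, where w
has degree at most E, whose dimension is E + 1. *)
Lemma exists_in_window (m E u : nat) (H : {set {poly_m F}}) :
    {in H &, forall h h', h - h' \in H} -> (q ^ m <= #|H| * q ^ E)%N ->
    (u + E < m)%N ->
  exists w : {poly F}, [/\ w != 0, (size w <= E.+1)%N &
    exists2 h, h \in H & val h = 'X^u * w].
Proof.
move=> HB Hq uE.
pose f (hw : {poly_m F} * {poly_E.+1 F}) : {poly_m F} :=
  npolyp m (val hw.1 + 'X^u * val hw.2).
have fE hw : val (f hw) = val hw.1 + 'X^u * val hw.2.
  rewrite /f; apply: npolypK; apply: leq_trans (size_polyD _ _) _.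
  rewrite geq_max size_npoly/=; have [->|w0] := eqVneq (val hw.2) 0.
    by rewrite mulr0 size_poly0.
  by rewrite size_monicM ?monicXn// size_polyXn; have := size_npoly hw.2; lia.
have : ~~ dinjectiveb f (finset.setX H finset.setT).
  apply/negP => /dinjectiveP finj.
  have := max_card (mem (f @: finset.setX H finset.setT)%SET).
  rewrite (card_in_imset finj) cardsX cardsT !card_npoly.
  rewrite leqNgt => /negP; apply.
  apply: (leq_ltn_trans Hq); rewrite ltn_pmul2l ?ltn_exp2l ?card_field_gt1//.
  by case: posnP Hq => // ->; rewrite mul0n leqn0 expn_eq0; have := card_field_gt1; lia.
move=> /dinjectivePn[[h w] hwH [[h' w'] /andP[/= neq h'w'H] /(congr1 val)]].
move: hwH h'w'H; rewrite !finset.in_setX !finset.in_setT !andbT => hH h'H.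
rewrite !fE /= => eqf; exists (val w' - val w); split.
- rewrite subr_eq0; apply/negP => /eqP ww; move: eqf; rewrite ww => /addIr hh.
  by move/eqP: neq; apply; congr (_, _); apply: val_inj.
- apply: leq_trans (size_polyD _ _) _; rewrite geq_max size_npoly/=.
  by rewrite size_polyN size_npoly.
- exists (h - h'); first exact: HB.
  rewrite [LHS](_ : _ = val h - val h')//.
  by rewrite [val h](canRL (addrK _) eqf); ring.
Qed.

Lemma smallD (N : nat) (a b : laurent F) : small N a -> small N b -> small N (a + b).
Proof. by move=> sa sb i iN /=; rewrite sa// sb// addr0. Qed.

Lemma smallN (N : nat) (a : laurent F) : small N a -> small N (- a).
Proof. by move=> sa i iN /=; rewrite sa// oppr0. Qed.

End Window.

Section Approximation.
Variables (p : nat) (F : finFieldType) (charF : p \in [pchar F]).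
Local Notation q := #|F|.

Lemma exprB_pow_pchar (k : nat) (x y : {poly F}) :
  (x - y) ^+ (p ^ k) = x ^+ (p ^ k) - y ^+ (p ^ k).
Proof.
have pchar_p : [pchar {poly F}].-nat (p ^ k)%N.
  by rewrite pnatX (eq_pnat _ (pchar_poly F)) pnatE ?(pcharf_prime charF)// charF.
by rewrite exprDn_pchar// exprNn_pchar.
Qed.

Lemma exprD_pow_pchar (k : nat) (x y : {poly F}) :
  (x + y) ^+ (p ^ k) = x ^+ (p ^ k) + y ^+ (p ^ k).
Proof.
have pchar_p : [pchar {poly F}].-nat (p ^ k)%N.
  by rewrite pnatX (eq_pnat _ (pchar_poly F)) pnatE ?(pcharf_prime charF)// charF.
by rewrite exprDn_pchar.
Qed.

Definition approx_set (m M P : nat) (a : laurent F) : {set {poly_m F}} :=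
  [set h : {poly_m F} | `[< small M (poly_laurent (val h ^+ P) * a) >]]%SET.

Lemma approx_setP m M P a h :
  reflect (small M (poly_laurent (val h ^+ P) * a)) (h \in approx_set m M P a).
Proof. by rewrite finset.in_set; exact: asboolP. Qed.

(** Let b be an element of the approximating set of degree at most E, and suppose
that the fractional part of b^P a has order -tau-1. If h belongs to the set and
P deg h <= tau, then the coefficient of h^P b^P a at -(tau - P deg h) - 1 is not
zero; but h^P a has a small fractional part, and b^P has a small
degree, so this index is large. Such h exist in every window of E + 1 degrees,
and with h of the largest possible degree this bounds tau from below. *)
Lemma rational_approximation (m M E k : nat) (a : laurent F) (P := (p ^ k)%N) :
    (q ^ m <= #|approx_set m M P a| * q ^ E)%N ->
    (E < m)%N -> (P * (2 * E + 1) <= M)%N ->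
  exists b : {poly_E.+1 F}, b != 0 /\
    small (P * m + M - P * (2 * E + 1)) (poly_laurent (val b ^+ P) * a).
Proof.
set H := approx_set _ _ _ _ => Hq Em PM.
have P0 : (0 < P)%N by rewrite expn_gt0 prime_gt0// (pcharf_prime charF).
have HB : {in H &, forall h h', h - h' \in H}.
  move=> h h' /approx_setP sh /approx_setP sh'; apply/approx_setP.
  rewrite [val _]/(val h - val h') exprB_pow_pchar raddfB mulrBl.
  by apply: smallD => //; apply: smallN.
clearbody P; have [w [w0 wE [h0 h0H h0E]]] := exists_in_window HB Hq (u := 0) Em.
rewrite expr0 mul1r in h0E.
exists (npolyp E.+1 w); split.
  by apply: contra w0 => /eqP w0; rewrite -(npolypK wE) w0.
rewrite [val _](npolypK wE); set th := poly_laurent _ * a.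
apply: contrapT => nsmall.
have ex : exists i, th (Negz i) != 0.
  apply: contrapT => /forallNP nex; apply: nsmall => i _.
  by apply/eqP/negP => /negP; exact: nex.
case: (ex_minnP ex) => tau th_tau tau_min.
have th_small : small tau th.
  move=> i itau; apply/eqP/negP => /negP /tau_min; lia.
have tauT : (tau < P * m + M - P * (2 * E + 1))%N.
  rewrite ltnNge; apply/negP => Ttau; apply: nsmall.
  exact: smallW th_small.
have Mtau : (M <= tau)%N.
  rewrite leqNgt; apply/negP => tauM; move/eqP: th_tau; apply.
  by move/approx_setP: h0H; rewrite h0E; apply.
(* The comparison of coefficients, for an h in the window above u. *)
have step u : (u + E < m)%N -> (P * (u + E) <= tau)%N -> (M + P * u <= tau + P * E)%N.
  move=> uEm PuE.
  have [w' [w'0 w'E [h hH hE]]] := exists_in_window HB Hq uEm.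
  have w's : (0 < size w')%N by rewrite size_poly_gt0.
  have hd : (size (val h)).-1 = (u + (size w').-1)%N.
    rewrite hE size_monicM ?monicXn// size_polyXn.
    by case: (size w') w's => // n _; rewrite addnS.
  have hPd : (size (val h ^+ P)).-1 = (P * (u + (size w').-1))%N.
    by rewrite size_exp hd mulnC.
  have w'd : (P * (u + (size w').-1) <= P * (u + E))%N by rewrite leq_mul2l; lia.
  have := @coef_lead_polyM _ tau (val h ^+ P) th th_small.
  rewrite hPd => /(_ (leq_trans w'd PuE)) lead.
  have hn0 : val h != 0 by rewrite hE mulf_neq0// -size_poly_eq0 size_polyXn.
  rewrite leqNgt; apply/negP => lt.
  have : lead_coef (val h ^+ P) * th (Negz tau) != 0.
    by rewrite mulf_neq0// lead_coef_eq0 expf_neq0.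
  rewrite -lead /th mulrCA => /eqP; apply.
  have shM : small M (poly_laurent (val h ^+ P) * a).
    exact/approx_setP.
  apply: (small_polyM (size_polyX_exp P wE) shM).
  by have : (P * u <= P * (u + (size w').-1))%N; [rewrite leq_mul2l; lia|]; lia.
(* Either the window just below m is allowed, or the best window ends at tau / P,
   and then the hypothesis on M is violated. *)
have [A|B] := leqP (P * m.-1) tau.
  have uEm : (m.-1 - E + E < m)%N by lia.
  have := step _ uEm; rewrite subnK; last by lia.
  move=> /(_ A); rewrite mulnBr.
  have : (P * m = P * m.-1 + P)%N by rewrite -{1}[m]prednK ?mulnS ?[(P + _)%N]addnC//; lia.
  have : (P * E <= P * m.-1)%N by rewrite leq_mul2l; lia.
  have : (P * (2 * E + 1) = 2 * (P * E) + P)%N by rewrite mulnDr muln1 mulnCA.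
  lia.
have := divn_eq tau P; have := ltn_pmod tau P0; set t := (tau %/ P)%N => rP tE.
have tm : (t < m.-1)%N.
  by rewrite -(ltn_pmul2l P0); apply: leq_ltn_trans B; rewrite mulnC; lia.
have PE : (P * (2 * E + 1) = 2 * (P * E) + P)%N by rewrite mulnDr muln1 mulnCA.
have Et : (E <= t)%N by rewrite /t leq_divRL// mulnC; lia.
have uEm : (t - E + E < m)%N by lia.
have := step _ uEm; rewrite subnK// mulnBr.
have := mulnC t P; have : (P * E <= P * t)%N by rewrite leq_mul2l Et orbT.
lia.
Qed.

End Approximation.

(** * Elimination of the variables of a monomial *)

Section Elimination.
Variables (p : nat) (F : finFieldType).
Local Notation q := #|F|.
Variables (I : finType) (m : nat).
Local Notation V := {poly_m F}.
Implicit Types (G : {set {ffun I -> V}}) (h : {ffun I -> V}).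

Definition fiber G j h : {set V} := [set v | upd h j v \in G]%SET.

Lemma in_fiber G j h v : (v \in fiber G j h) = (upd h j v \in G).
Proof. by rewrite finset.in_set. Qed.

Lemma sum_fiber G j : (\sum_h #|fiber G j h| = q ^ m * #|G|)%N.
Proof. by rewrite card_upd card_npoly. Qed.

(** The fibers of relative size below q^-(E+1) hold at most half of a set of
relative size q^-E. *)
Lemma many_large_fibers j G E : (#|{ffun I -> V}| <= #|G| * q ^ E)%N ->
  (#|{ffun I -> V}|
    <= #|[set h | (q ^ m <= #|fiber G j h| * q ^ E.+1)%N]%SET| * q ^ E.+1)%N.
Proof.
move=> GE; set G1 := [set h | _]%SET; set T := #|{ffun I -> V}| in GE *.
have q0 : (0 < q ^ E.+1)%N by rewrite expn_gt0 (ltnW (card_field_gt1 F)).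
have N0 : (0 < q ^ m)%N by rewrite expn_gt0 (ltnW (card_field_gt1 F)).
have : (\sum_h #|fiber G j h| * q ^ E.+1
        <= \sum_h ((h \in G1) * (q ^ m * q ^ E.+1) + q ^ m))%N.
  apply: leq_sum => h _; rewrite inE.
  case: (leqP (q ^ m) (#|fiber G j h| * q ^ E.+1)) => [_|/ltnW]; last by [].
  rewrite mul1n -[X in (X <= _)%N]addn0 leq_add// leq_mul2r -(card_npoly F m).
  by rewrite max_card orbT.
rewrite -big_distrl/= sum_fiber big_split/= sum_nat_const -big_distrl/=.
have -> : (\sum_h (h \in G1) = #|G1|)%N by rewrite -sum1_card [RHS]big_mkcond.
rewrite -/T.
have -> : (#|G1| * (q ^ m * q ^ E.+1) + T * q ^ m
           = q ^ m * (#|G1| * q ^ E.+1 + T))%N by ring.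
rewrite -mulnA leq_pmul2l//.
have : (q * T <= #|G| * q ^ E.+1)%N by rewrite expnS mulnCA leq_mul2l GE orbT.
have : (2 * T <= q * T)%N by rewrite leq_mul2r (card_field_gt1 F) orbT.
move: (q * T)%N (#|G| * _)%N (#|G1| * _)%N => x y z; lia.
Qed.

Definition monomial (s : seq I) (a : I -> nat) h : {poly F} :=
  \prod_(i <- s) val (h i) ^+ (p ^ a i).

Lemma monomial_upd s a h j v : j \notin s ->
  monomial s a (upd h j v) = monomial s a h.
Proof.
move=> js; apply: eq_big_seq => i iS; rewrite upd_other//.
by apply: contraNneq js => <-.
Qed.

End Elimination.

(** Many tuples have a large fiber in the direction j, which gives an approximation
with some b of degree at most E + 1; there are only q^(E+2) such b, so that one b
serves for a large set of tuples, on which the entry j is no longer constrained. *)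
Lemma eliminate_variables (p : nat) (I : finType) (s : seq I) (a : I -> nat) :
    prime p -> uniq s ->
  exists C : nat, forall (F : finFieldType) (charF : p \in [pchar F])
    (m M E : nat) (G : {set {ffun I -> {poly_m F}}}) (x : laurent F),
    (forall h, h \in G -> small M (poly_laurent (monomial p s a h) * x)) ->
    (#|{ffun I -> {poly_m F}}| <= #|G| * #|F| ^ E)%N ->
    (C * E.+1 <= m)%N -> (C * E.+1 <= M)%N ->
  exists b : {poly F}, [/\ b != 0, (size b <= C * E.+1)%N &
    small (M + (\sum_(i <- s) p ^ a i) * m - C * E.+1) (poly_laurent b * x)].
Proof.
move=> p_prime; elim: s => [_|j s IHs /= /andP[js us]].
  exists 1%N => F charF m M E G x GM GE _ _; exists 1.
  rewrite oner_eq0 size_poly1 big_nil mul0n addn0; split=> //.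
  have [h hG] : exists h, h \in G.
    apply/set0Pn; apply: contraTneq GE => ->; rewrite cards0 mul0n leqNgt.
    by rewrite card_ffun card_npoly !expn_gt0 (ltnW (card_field_gt1 F)).
  by have := GM h hG; rewrite /monomial big_nil; apply: smallW; lia.
have [C IH] := IHs us; pose P := (p ^ a j)%N.
have P0 : (0 < P)%N by rewrite expn_gt0 prime_gt0.
exists (4 * C + 3 * P + 1)%N => F charF m M E G x GM GE Cm CM.
have q0 : (0 < #|F|)%N by rewrite (ltnW (card_field_gt1 F)).
pose y (h : {ffun I -> {poly_m F}}) := poly_laurent (monomial p s a h) * x.
have fib h : fiber G j h \subset approx_set m M P (y h).
  apply/fintype.subsetP => v; rewrite inE => vG; apply/approx_setP.
  have := GM _ vG; rewrite /monomial big_cons upd_same -/(monomial p s a _).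
  by rewrite monomial_upd// rmorphM mulrA.
have := many_large_fibers j GE; set G1 := [set h | _]%SET => G1E.
pose M' := (P * m + M - P * (2 * E.+1 + 1))%N.
pose Gb (b : {poly_E.+2 F}) := [set h | (b != 0) &&
  `[< small M' (poly_laurent (val b ^+ P) * y h) >] ]%SET.
have e1 : ((4 * C + 3 * P + 1) * E.+1
           = 4 * (C * E) + 4 * C + 3 * (P * E) + 3 * P + E + 1)%N by ring.
have e2 : (C * (2 * E + 3).+1 = 2 * (C * E) + 4 * C)%N by ring.
have e3 : (P * (2 * E.+1 + 1) = 2 * (P * E) + 3 * P)%N by ring.
have e4 : (P * E.+1 = P * E + P)%N by ring.
have PE : (P * (2 * E.+1 + 1) <= (4 * C + 3 * P + 1) * E.+1)%N by lia.
have [b bG] : exists b, (#|G1| <= #|Gb b| * #|{: {poly_E.+2 F}}|)%N.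
  apply: (pigeonhole_cover 0) => h; rewrite inE => hG1.
  have [|||b [b0 sb]] := @rational_approximation p F charF m M E.+1 (a j) (y h).
  - by apply: leq_trans hG1 _; rewrite leq_mul2r subset_leq_card ?orbT ?fib.
  - by lia.
  - by apply: leq_trans PE _.
  by exists b; rewrite inE b0; apply/asboolP.
have bG0 : (0 < #|Gb b|)%N.
  rewrite lt0n; apply/negP => /eqP b0; move: bG; rewrite b0 mul0n leqn0 => /eqP G10.
  move: G1E; rewrite G10 mul0n leqNgt.
  by rewrite card_ffun card_npoly !expn_gt0 q0.
have b0 : b != 0 by case/card_gt0P: bG0 => h; rewrite inE => /andP[].
have [||||b' [b'0 sb' smallb']] := IH F charF m M' (2 * E + 3)%N (Gb b)
    (poly_laurent (val b ^+ P) * x).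
- move=> h; rewrite inE => /andP[_ /asboolP].
  by rewrite /y mulrCA.
- apply: leq_trans G1E _.
  apply: leq_trans (_ : _ <= #|Gb b| * #|F| ^ E.+2 * #|F| ^ E.+1)%N _.
    by rewrite leq_mul2r -(card_npoly F E.+2) bG orbT.
  by rewrite -mulnA -expnD leq_mul2l leq_exp2l ?card_field_gt1//; apply/orP; right; lia.
- by lia.
- by rewrite /M'; lia.
exists (b' * val b ^+ P); split.
- rewrite mulf_neq0// expf_neq0//.
- apply: leq_trans (size_polyMleq _ _) _.
  have : (size (val b ^+ P) <= (P * E.+1).+1)%N.
    exact: (size_polyX_exp P (size_npoly b)).
  by move: sb'; move: (size b') (size (val b ^+ P)) => u v; lia.
- rewrite rmorphM -mulrA; apply: smallW smallb'.
  by rewrite big_cons -/P /M' mulnDl; lia.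
Qed.

(** * Separation of the monomials of a form *)

Lemma leq_card_fibers (T U : finType) (D : {set T}) (f : T -> U) (n : nat) :
  (forall z, (#|[set d in D | f d == z]%SET| <= n)%N) -> (#|D| <= #|U| * n)%N.
Proof.
move=> fn; rewrite -sum1_card (partition_big f xpredT)//= -sum_nat_const.
apply: leq_sum => z _; apply: leq_trans (fn z); rewrite -sum1_card.
by rewrite [X in (_ <= X)%N](eq_bigl (fun d => (d \in D) && (f d == z)))// => d; rewrite inE.
Qed.

Section Forms.
Variables (p : nat) (I Tm : finType) (l : I) (b : Tm -> I -> nat).

(** A form in the variables H i, additive in each of them: the term t has the
coefficient g t and the exponents p ^ b t i. The place l is that of the variable
whose character is considered. *)
Definition term_sum (F : fieldType) (g : Tm -> laurent F) (H : I -> {poly F}) : laurent F :=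
  \sum_t g t * poly_laurent (\prod_i H i ^+ (p ^ b t i)).

Definition put (T : Type) (j : I) (y : T) (H : I -> T) : I -> T :=
  fun i => if i == j then y else H i.

(** The factor that the monomial t acquires in [term_sum_separator] for the
parameters o = (j, c, d). It vanishes if and only if c + b t j = d + b t l. *)
Definition separator (F : fieldType) (o : I * nat * nat) (t : Tm) : {poly F} :=
  'X^(p ^ (o.1.2 + b t o.1.1)) - 'X^(p ^ (o.2 + b t l)).

Lemma term_sum_separator (F : fieldType) (g : Tm -> laurent F) j c d (H : I -> {poly F}) :
  term_sum (fun t => g t * poly_laurent (separator F (j, c, d) t))%R H
  = term_sum g (put j ('X^(p ^ c) * H j) H) - term_sum g (put l ('X^(p ^ d) * H l) H).
Proof.
rewrite /term_sum -sumrB; apply: eq_bigr => t _.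
rewrite -mulrA -rmorphM -mulrBr -raddfB; congr (_ * poly_laurent _).
have pull (i : I) (e : nat) : \prod_i' put i ('X^(p ^ e) * H i) H i' ^+ (p ^ b t i')
    = 'X^(p ^ (e + b t i)) * \prod_i' H i' ^+ (p ^ b t i').
  rewrite (bigD1 i)//= [in RHS](bigD1 i)//= /put eqxx exprMn -exprM -expnD -mulrA.
  by congr (_ * (_ * _)); apply: eq_bigr => i' /negbTE ->.
by rewrite !pull mulrBl.
Qed.

Section TrivialTuples.
Variables (F : finFieldType) (charF : p \in [pchar F]).
Local Notation q := #|F|.

Lemma term_sumB (g : Tm -> laurent F) j (H1 H2 H3 : I -> {poly F}) :
    (forall i, i != j -> H1 i = H3 i) -> (forall i, i != j -> H2 i = H3 i) ->
    H3 j = H1 j - H2 j ->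
  term_sum g H3 = term_sum g H1 - term_sum g H2.
Proof.
move=> H13 H23 Hj; rewrite /term_sum -sumrB; apply: eq_bigr => t _.
rewrite -mulrBr -raddfB; congr (_ * poly_laurent _).
rewrite (bigD1 j)//= Hj (exprB_pow_pchar charF) mulrBl.
congr (_ - _); rewrite [RHS](bigD1 j)//=; congr (_ * _).
  by apply: eq_bigr => i /H13 ->.
by apply: eq_bigr => i /H23 ->.
Qed.

Variable m : nat.
Local Notation V := {poly_m F}.
Implicit Types (h : {ffun I -> V}) (g : Tm -> laurent F).

(** The character is taken in the variable at l, whose value y replaces the entry of
the tuple at l; so the densities refer to tuples indexed by all of I. *)
Definition trivial_tuples M g : {set {ffun I -> V}} :=
  [set h : {ffun I -> V} | `[< forall y : {poly F}, (size y <= M)%N ->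
    psi charF (term_sum g (put l y (fun i => val (h i)))) = 0 >]]%SET.

Lemma trivial_tuplesP M g h : reflect
  (forall y : {poly F}, (size y <= M)%N ->
     psi charF (term_sum g (put l y (fun i => val (h i)))) = 0) (h \in trivial_tuples M g).
Proof. by rewrite finset.in_set; exact: asboolP. Qed.

Lemma fiber_trivial_tuplesB M g j h v v' : j != l -> v \in fiber (trivial_tuples M g) j h ->
  v' \in fiber (trivial_tuples M g) j h -> v - v' \in fiber (trivial_tuples M g) j h.
Proof.
rewrite !in_fiber => jl /trivial_tuplesP gv /trivial_tuplesP gv'.
apply/trivial_tuplesP => y yM.
rewrite (@term_sumB g j (put l y (fun i => val (upd h j v i)))
  (put l y (fun i => val (upd h j v' i)))).
- by rewrite psiB gv// gv'// subrr.
- by move=> i ij; rewrite /put !upd_other.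
- by move=> i ij; rewrite /put !upd_other.
- by rewrite /put (negbTE jl) !upd_same.
Qed.

(** The fiber is a group H, and v lies in the new fiber if v and X^(p^c) v are both in
H. Consider the map (v, u) |-> X^(p^c) v + u on H x H: two pairs with the same
image differ in v by such an element. *)
Lemma card_fiber_separator M g j c d h : j != l ->
  (#|fiber (trivial_tuples M g) j h| ^ 2 <= q ^ (m + p ^ c) *
   #|fiber (trivial_tuples (M - p ^ d)
       (fun t => g t * poly_laurent (separator F (j, c, d) t))%R) j h|)%N.
Proof.
move=> jl; set H := fiber _ _ _; set A := fiber _ _ _.
pose f (vu : V * V) : {poly_(m + p ^ c) F} :=
  npolyp _ ('X^(p ^ c) * val vu.1 + val vu.2).
have fE vu : val (f vu) = 'X^(p ^ c) * val vu.1 + val vu.2.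
  rewrite /f; apply: npolypK; apply: leq_trans (size_polyD _ _) _.
  rewrite geq_max (leq_trans (size_npoly _)) ?leq_addr// andbT.
  have [->|v0] := eqVneq (val vu.1) 0; first by rewrite mulr0 size_poly0.
  have sv : (size (val vu.1) <= m)%N := size_npoly vu.1.
  by rewrite size_monicM ?monicXn// size_polyXn addSn addnC leq_add.
rewrite -mulnn -cardsX -card_npoly; apply: (leq_card_fibers (f := f)) => z.
have [->|[[v0 u0]]] := set_0Vmem [set vu in finset.setX H H | f vu == z]%SET.
  by rewrite cards0.
rewrite inE finset.in_setX /= => /andP[/andP[v0H u0H] /eqP f0].
pose D := [set vu in finset.setX H H | f vu == z]%SET.
have sub vu : vu \in D -> 'X^(p ^ c) * (val vu.1 - val v0) = val u0 - val vu.2.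
  rewrite inE => /andP[_ /eqP fz]; have := congr1 val (etrans fz (esym f0)).
  rewrite !fE /= => /eqP; rewrite -subr_eq => /eqP E.
  by rewrite mulrBr -E; ring.
have inj : {in D &, injective (fun vu : V * V => vu.1 - v0)}.
  move=> [v u] [v' u'] Dv Dv' /= /addIr vv'; have := sub _ Dv; have := sub _ Dv'.
  rewrite /= vv' => -> /eqP; rewrite eq_sym => /eqP /addrI /oppr_inj uu'.
  by congr (_, _); apply: val_inj.
rewrite -(card_in_imset inj); apply: subset_leq_card.
apply/fintype.subsetP => w /imsetP[[v u] Dv ->]; rewrite /=.
have := sub _ Dv; rewrite /= => shift.
move: Dv; rewrite inE finset.in_setX /= => /andP[/andP[vH uH] _].
have := fiber_trivial_tuplesB jl vH v0H; have := fiber_trivial_tuplesB jl u0H uH.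
rewrite !in_fiber => /trivial_tuplesP gu /trivial_tuplesP gv; apply/trivial_tuplesP => y yM.
rewrite term_sum_separator psiB.
have -> : psi charF (term_sum g (put j ('X^(p ^ c) *
    put l y (fun i => val (upd h j (v - v0) i)) j)
    (put l y (fun i => val (upd h j (v - v0) i))))) = 0.
  rewrite -[RHS](gu y); last by apply: leq_trans yM _; exact: leq_subr.
  congr (psi _ (term_sum _ _)); apply/funext => i; rewrite /put.
  have [->|ij] := eqVneq i j; last by rewrite !upd_other.
  by rewrite (negbTE jl) !upd_same /= shift.
rewrite sub0r; apply/eqP; rewrite oppr_eq0; apply/eqP.
rewrite -[RHS](gv ('X^(p ^ d) * y)).
  congr (psi _ (term_sum _ _)); apply/funext => i; rewrite /put.
  by case: (i =P l) => // _; rewrite eqxx.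
have [->|y0] := eqVneq y 0; first by rewrite mulr0 size_poly0.
have := y0; rewrite -size_poly_gt0 => sy.
by rewrite size_monicM ?monicXn// size_polyXn; lia.
Qed.

(** The fiberwise bound, averaged with the Cauchy-Schwarz inequality. *)
Lemma card_trivial_tuples_separator M E g j c d : j != l ->
    (#|{ffun I -> V}| <= #|trivial_tuples M g| * q ^ E)%N ->
  (#|{ffun I -> V}|
   <= #|trivial_tuples (M - p ^ d) (fun t => g t * poly_laurent (separator F (j, c, d) t))%R|
      * q ^ (2 * E + p ^ c))%N.
Proof.
move=> jl; set G := trivial_tuples M g; set G' := trivial_tuples _ _.
set T := #|{ffun I -> V}|; pose N := (q ^ m)%N; move=> TE.
have q0 : (0 < q)%N by rewrite (ltnW (card_field_gt1 F)).
have N0 : (0 < N)%N by rewrite expn_gt0 q0.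
have T0 : (0 < T)%N by rewrite /T card_ffun card_npoly !expn_gt0 q0.
have GG' : (#|G| ^ 2 <= T * q ^ (p ^ c) * #|G'|)%N.
  have NN0 : (0 < N ^ 2)%N by rewrite expn_gt0 N0.
  rewrite -(leq_pmul2l NN0) -expnMn /N -(sum_fiber G j).
  apply: leq_trans (sqr_sum_leq _) _.
  rewrite [X in (_ <= X)%N](_ : _ =
      T * (q ^ (m + p ^ c) * (q ^ m * #|G'|)))%N; last first.
    by rewrite expnD; ring.
  rewrite -(sum_fiber G' j) leq_mul2l [X in (_ <= X)%N]big_distrr /=.
  by apply/orP; right; apply: leq_sum => h _; exact: card_fiber_separator.
rewrite -(leq_pmul2l T0); apply: (@leq_trans (#|G| ^ 2 * q ^ (2 * E))%N).
  by rewrite [(2 * E)%N]mulnC expnM -expnMn mulnn leq_sqr.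
apply: (@leq_trans (T * q ^ (p ^ c) * #|G'| * q ^ (2 * E))%N).
  by rewrite leq_mul2r GG' orbT.
by rewrite expnD leq_eqVlt; apply/orP; left; apply/eqP; ring.
Qed.

End TrivialTuples.

Lemma card_trivial_tuples_separators (ops : seq (I * nat * nat)) :
    all (fun o => o.1.1 != l) ops ->
  exists C : nat, forall (F : finFieldType) (charF : p \in [pchar F])
    (m M E : nat) (g : Tm -> laurent F),
    (#|{ffun I -> {poly_m F}}| <= #|trivial_tuples charF m M g| * #|F| ^ E)%N ->
  (#|{ffun I -> {poly_m F}}|
    <= #|trivial_tuples charF m (M - C)
          (fun t => g t * poly_laurent (\prod_(o <- ops) separator F o t))%R|
       * #|F| ^ (C * E.+1))%N.
Proof.
elim: ops => [_|[[j c] d] ops IHo /= /andP[jl /IHo [C IH]]].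
  exists 1%N => F charF m M E g gE.
  have -> : (fun t => g t * poly_laurent (\prod_(o <- [::]) separator F o t))%R = g.
    by apply/funext => t; rewrite big_nil rmorph1 mulr1.
  apply: leq_trans gE _; apply: leq_mul.
    apply: subset_leq_card; apply/fintype.subsetP => h /trivial_tuplesP gh.
    apply/trivial_tuplesP => y yM.
    by apply: gh; lia.
  by rewrite leq_exp2l ?card_field_gt1//; lia.
exists (C * (p ^ c + 2) + p ^ d)%N => F charF m M E g gE.
have := IH F charF m _ _ _ (@card_trivial_tuples_separator F charF m M E g j c d jl gE).
have -> : (fun t => g t * poly_laurent (separator F (j, c, d) t) *
      poly_laurent (\prod_(o <- ops) separator F o t))%R =
    (fun t => g t * poly_laurent (\prod_(o <- (j, c, d) :: ops) separator F o t))%R.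
  by apply/funext => t; rewrite big_cons rmorphM mulrA.
move=> le1; apply: leq_trans le1 _; apply: leq_mul.
  apply: subset_leq_card; apply/fintype.subsetP => h /trivial_tuplesP gh.
  apply/trivial_tuplesP => y yM.
  by apply: gh; apply: leq_trans yM _; nia.
rewrite leq_exp2l ?card_field_gt1//; nia.
Qed.

Lemma size_separators (ops : seq (I * nat * nat)) (t : Tm) :
  exists C : nat, forall F : fieldType,
    (size (\prod_(o <- ops) separator F o t)%R <= C.+1)%N.
Proof.
elim: ops => [|o ops [C IH]]; first by exists 0 => F; rewrite big_nil size_poly1.
exists (C + p ^ (o.1.2 + b t o.1.1) + p ^ (o.2 + b t l))%N => F; rewrite big_cons.
apply: leq_trans (size_polyMleq _ _) _.
have : (size (separator F o t) <= (p ^ (o.1.2 + b t o.1.1) + p ^ (o.2 + b t l)).+1)%N.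
  apply: leq_trans (size_polyD _ _) _; rewrite size_polyN !size_polyXn geq_max; lia.
by have := IH F; lia.
Qed.

End Forms.

(** * Base p words *)

Section Words.
Variable p : nat.
Hypothesis p_prime : prime p.

(** The digits are listed with multiplicity, the lowest ones last. The default value
1 of last makes the final clause say that the word is not empty. *)
Lemma digit_word r : exists w : seq nat,
  [/\ \sum_(a <- w) p ^ a = r, (forall v, count_mem v w < p) &
      (coprime r p -> last 1 w = 0)]%N.
Proof.
have p1 := prime_gt1 p_prime; have p0 := prime_gt0 p_prime.
have [n] := ubnP r; elim: n r => // n IHn r; rewrite ltnS => rn.
have [->|r0] := posnP r.
  exists [::]; split; rewrite ?big_nil//.
  by rewrite /coprime gcd0n => /eqP pE; have := p_prime; rewrite pE.
have [|w [wr wp _]] := IHn (r %/ p)%N.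
  by apply: leq_trans rn; exact: ltn_Pdiv.
exists ([seq a.+1 | a <- w] ++ nseq (r %% p) 0%N); split.
- rewrite big_cat big_map big_nseq iter_addn_0 mul1n.
  under eq_bigr do rewrite expnS; rewrite -big_distrr /= wr mulnC.
  exact: (esym (divn_eq r p)).
- move=> [|v]; rewrite count_cat count_nseq count_map /=.
    rewrite (eq_count (a2 := pred0)) => [|a //].
    by rewrite count_pred0 mul1n ltn_mod.
  by rewrite mul0n addn0 (eq_count (a2 := pred1 v)) => [|a]; [exact: wp|exact: eqSS].
- rewrite coprime_sym prime_coprime// /dvdn => rp; rewrite last_cat.
  by case: (r %% p)%N rp => // c _; elim: c.
Qed.

(** Otherwise some permutation of order p fixes the word. It moves some place, and the
orbit of this place consists of p places with the same letter. *)
Lemma stabilizer_coprime (D : nat) (w : seq nat) : size w = D ->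
    (forall v, (count_mem v w < p)%N) ->
  ~~ (p %| #|[set s : {perm 'I_D} | [forall i, nth 0%N w (s i) == nth 0%N w i]]%SET|)%N.
Proof.
move=> wD wp; set St := [set s | _]%SET.
have StP (s : {perm 'I_D}) : reflect (forall i, nth 0%N w (s i) = nth 0%N w i) (s \in St).
  by rewrite finset.in_set; apply: 'forall_eqP.
have gSt : group_set St.
  apply/group_setP; split; first by apply/StP => i; rewrite perm1.
  by move=> s s' /StP Ss /StP Ss'; apply/StP => i; rewrite permM Ss'.
apply/negP => pSt; have [x xSt ox] := Cauchy p_prime (pSt : (p %| #|Group gSt|)%N).
have [i xi] : exists i, x i != i.
  apply/existsP; apply: contraT => /existsPn xid.
  have x1 : x = 1%g by apply/permP => i; rewrite perm1; apply/eqP; rewrite -[_ == _]negbK.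
  by have := p_prime; rewrite -ox x1 order1.
have : (#|porbit x i| %| p)%N by rewrite -ox porbitE; exact: dvdn_orbit.
move/((primeP p_prime).2) => /orP[/eqP o1|/eqP op].
  have := porbit_id x i; have := mem_porbit x 1 i; rewrite expg1.
  have /cards1P[y ->] : #|porbit x i| == 1%N by rewrite o1.
  by rewrite !finset.in_set1 => /eqP xy /eqP iy; rewrite xy -iy eqxx in xi.
have := wp (nth 0%N w i); rewrite ltnNge => /negP; apply.
rewrite -op; have sub : porbit x i \subset [pred j : 'I_D | nth 0%N w j == nth 0%N w i].
  apply/fintype.subsetP => j /porbitP[n ->]; rewrite inE.
  by elim: n => [|n IHn]; rewrite ?perm1// expgSr permM (StP _ xSt).
apply: leq_trans (subset_leq_card sub) _.
rewrite -sum1_card -sum1_count (big_nth 0%N) wD big_mkord.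
by rewrite leq_eqVlt; apply/orP; left; apply/eqP; apply: eq_bigl => j; rewrite inE.
Qed.

End Words.

(** * From large sums to trivial characters *)

Section WeylTrivialTuples.
Variables (R : realType) (p : nat) (F : finFieldType) (charF : p \in [pchar F]).
Local Notation q := #|F|.
Local Notation e := (echar R charF).
Local Notation psi := (psi charF).

Lemma echarN a : e (- a) = (e a)^*.
Proof.
have ea : e a != 0 by rewrite -normr_eq0 echar_norm oner_eq0.
by apply: (mulfI ea); rewrite -echarD addrN echar0 -normCK echar_norm expr1n.
Qed.

Variables (I Tm : finType) (l : I) (b : Tm -> I -> nat) (m : nat).
Local Notation V := {poly_m F}.

Lemma mdiff_echar s (h : {ffun I -> V}) (f : V -> laurent F) x :
  mdiff s h (fun x => e (f x)) x = e (adiff s h f x).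
Proof. by elim: s x => //= j s IHs x; rewrite !IHs echarD echarN. Qed.

Lemma adiff_eq s (h h' : I -> V) (f : V -> laurent F) x :
  {in s, h =1 h'} -> adiff s h f x = adiff s h' f x.
Proof.
elim: s x => //= j s IHs x hh'.
have sub : {in s, h =1 h'} by move=> i iS; apply: hh'; rewrite inE iS orbT.
by rewrite !IHs// hh'// inE eqxx.
Qed.

(** After differencing along all places but l, the phase is an additive function of x
plus a constant, and a translation of x by v multiplies the sum by the character
of v; so the sum vanishes unless this character is trivial. *)
Lemma weyl_trivial_tuples (s : seq I) (f : V -> laurent F) (g : Tm -> laurent F) (E : nat) :
    uniq (l :: s) ->
    (forall (h : I -> V) x,
       adiff (l :: s) h f x = term_sum p b g (fun i => val (h i))) ->
    (q ^ m)%:R <= `|\sum_x e (f x)| * (q ^ E)%:R ->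
  (#|{ffun I -> V}| <= #|trivial_tuples l b charF m m g| * q ^ (E * 2 ^ size s))%N.
Proof.
move=> /= /andP[ls us] poly large; set k := size s.
have := weyl_differencing (fun x => e (f x)) us; set S := `|_| in large *.
rewrite -/k; set Z := \sum_h _ => weyl.
have q0 : (0 < q)%N by rewrite (ltnW (card_field_gt1 F)).
have VE : #|V| = (q ^ m)%N by rewrite card_npoly.
have ZE : Z <= (#|trivial_tuples l b charF m m g| * q ^ m)%:R.
  rewrite -sum1_card big_distrl /= natr_sum big_mkcond [X in _ <= X]/=.
  rewrite [X in _ <= X]big_mkcond; apply: ler_sum => h _; case: ifPn => [_|].
    apply: le_trans (ler_norm_sum _ _ _) _; rewrite -VE mul1n -sum1_card natr_sum.
    by apply: ler_sum => x _; rewrite mdiff_echar echar_norm.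
  move=> hbad; rewrite le_eqVlt normr_eq0; apply/orP; left; apply: contraNT hbad.
  move=> Sn0; apply/trivial_tuplesP => y ym.
  set mu := term_sum _ _ _ _; pose v : V := npolyp m y.
  have shift x : adiff s h f (x + v) = mu + adiff s h f x.
    have sh : {in s, h =1 upd h l v}.
      by move=> i iS; rewrite upd_other//; apply: contraNneq ls => <-.
    rewrite !(adiff_eq _ _ sh); apply/eqP; rewrite -subr_eq.
    have := poly (upd h l v) x; rewrite /= upd_same => ->.
    apply/eqP; congr term_sum; apply/funext => i; rewrite ffunE /put.
    by case: eqP => // _; exact: npolypK.
  apply: (@echar_eq1 p F charF R); apply: (mulIf Sn0); rewrite mul1r mulr_sumr.
  rewrite [RHS](reindex_inj (addIr v)) /=; apply: eq_bigr => x _.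
  by rewrite !mdiff_echar shift echarD.
have N0 : 0 < ((q ^ m) ^ (2 ^ k))%:R :> R[i] by rewrite ltr0n !expn_gt0 q0.
rewrite -(ler_nat R[i]) -(ler_pM2l N0) card_ffun VE.
apply: (@le_trans _ _ (S ^+ (2 ^ k) * ((q ^ E) ^ (2 ^ k))%:R * (((q ^ m) ^ #|I|)%:R))).
  rewrite ler_wpM2r ?ler0n// !natrX -exprMn -!natrX.
  rewrite natrX; apply: lerXn2r; rewrite ?nnegrE ?ler0n ?mulr_ge0 ?ler0n ?normr_ge0//.
rewrite mulrAC; apply: (@le_trans _ _ (((q ^ m) ^ (2 ^ k))%:R *
    (#|trivial_tuples l b charF m m g|)%:R * ((q ^ E) ^ (2 ^ k))%:R)).
  rewrite ler_wpM2r ?ler0n// -VE; apply: le_trans weyl _.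
  apply: le_trans (ler_wpM2l (ler0n _ _) ZE) _; rewrite -!natrM ler_nat VE.
  have [d ->] : exists d, (2 ^ k = d.+1)%N by exists (2 ^ k).-1; rewrite prednK// expn_gt0.
  by rewrite expnSr /= leq_eqVlt; apply/orP; left; apply/eqP; ring.
by rewrite -!natrM ler_nat mulnA expnM.
Qed.

End WeylTrivialTuples.

(** ** Differences of powers of affine functions *)

Section PowerDifferences.
Variables (p : nat) (F : finFieldType) (charF : p \in [pchar F]) (m D : nat).
Local Notation V := {poly_m F}.
Implicit Types (g c : {poly F}) (w : seq nat) (h : 'I_D -> V).

Let exp_word w (S : {set 'I_D}) g c h (x : V) :
  (g * val (x + \sum_(i in S) h i) + c) ^+ (\sum_(a <- w) p ^ a)
  = \prod_(j < size w) ((g * val x + c) ^+ (p ^ nth 0 w j)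
      + \sum_(i in S) (g * val (h i)) ^+ (p ^ nth 0 w j)).
Proof.
have expr_pow_pchar_sum (a : nat) (f : 'I_D -> {poly F}) :
    (\sum_(i in S) f i) ^+ (p ^ a) = \sum_(i in S) f i ^+ (p ^ a).
  apply: (big_morph (fun y : {poly F} => y ^+ (p ^ a))) => [y z|].
    exact: exprD_pow_pchar charF _ _ _.
  by rewrite expr0n expn_eq0; case: p charF => // /pcharf_prime.
rewrite expr_sum (big_nth 0%N) big_mkord; apply: eq_bigr => j _.
rewrite -expr_pow_pchar_sum -(exprD_pow_pchar charF) -mulr_sumr; congr (_ ^+ _).
by rewrite raddfD raddf_sum /= mulrDr addrAC.
Qed.

Let sum_exp_word w g c h (x : V) :
  \sum_(S : {set 'I_D}) (-1) ^+ #|S| *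
      (g * val (x + \sum_(i in S) h i) + c) ^+ (\sum_(a <- w) p ^ a)
  = \sum_(S : {set 'I_D}) (-1) ^+ #|S| *
      \prod_(j < size w) ((g * val x + c) ^+ (p ^ nth 0 w j)
        + \sum_(i in S) (g * val (h i)) ^+ (p ^ nth 0 w j)).
Proof. by apply: eq_bigr => S _; rewrite exp_word. Qed.

Lemma adiff_power_lt s w g c h x : uniq s -> s =i 'I_D -> (size w < D)%N ->
  adiff s h (fun x => (g * val x + c) ^+ (\sum_(a <- w) p ^ a)) x = 0.
Proof.
move=> us sI wD; rewrite adiff_full// sum_exp_word.
by rewrite ryser_lt ?mulr0// !card_ord.
Qed.

Lemma adiff_power_eq s w g c h x : uniq s -> s =i 'I_D -> size w = D ->
  adiff s h (fun x => (g * val x + c) ^+ (\sum_(a <- w) p ^ a)) x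
  = g ^+ (\sum_(a <- w) p ^ a) *
    \sum_(t : {perm 'I_D}) \prod_i val (h i) ^+ (p ^ nth 0%N w (t i)).
Proof.
move=> us sI wD; rewrite adiff_full// sum_exp_word wD.
rewrite (ryser_eq (fun j => (g * val x + c) ^+ (p ^ nth 0%N w (j : 'I_D)))
  (fun j i => (g * val (h i)) ^+ (p ^ nth 0%N w (j : 'I_D)))).
rewrite mulrA -exprD addnn -mul2n exprM sqrrN !expr1n mul1r mulr_sumr.
apply: eq_bigr => t _; rewrite expr_sum (big_nth 0%N) big_mkord wD.
rewrite [X in _ = X * _](reindex_inj (@perm_inj _ t)) -big_split.
by apply: eq_bigr => i _; rewrite exprMn.
Qed.

End PowerDifferences.

(** * The coefficients with the largest digit sum *)

Lemma laurentMn (F : fieldType) (a : laurent F) (n : nat) (j : int) :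
  (a *+ n) j = a j *+ n.
Proof. by elim: n => [|n IHn]; rewrite ?mulr0n// !mulrSr /= -IHn. Qed.

Lemma small_mulrn (p : nat) (F : fieldType) (N n : nat) (a : laurent F) :
  p \in [pchar F] -> ~~ (p %| n)%N -> small N (a *+ n) -> small N a.
Proof.
move=> charF pn sa i iN; have := sa i iN; rewrite laurentMn -mulr_natr => /eqP.
by rewrite mulf_eq0 -(dvdn_pcharf charF) (negbTE pn) orbF => /eqP.
Qed.

Lemma adiff_scaled (F : fieldType) (I : finType) (V : zmodType) (s : seq I)
    (h : I -> V) (c : laurent F) (f : V -> {poly F}) x :
  adiff s h (fun x => c * poly_laurent (f x)) x = c * poly_laurent (adiff s h f x).
Proof. by elim: s x => //= j s IHs x; rewrite !IHs raddfB mulrBr. Qed.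

Section TopCoefficient.
Variables (R : realType) (p k : nat) (r : 'I_k -> nat) (w : 'I_k -> seq nat).
Hypothesis p_prime : prime p.
Hypothesis w_sum : forall j, (\sum_(a <- w j) p ^ a)%N = r j.
Hypothesis w_lt : forall j v, (count_mem v (w j) < p)%N.
Hypothesis w_last : forall j, last 1%N (w j) = 0%N.
Hypothesis r_inj : injective r.

Section Words.
Variables (D : nat) (j0 : 'I_k).
Hypothesis wj0 : size (w j0) = D.+1.

Let l : 'I_D.+1 := ord_max.
Let Tm := ('I_k * {perm 'I_D.+1})%type.
Let b (t : Tm) (i : 'I_D.+1) : nat := nth 0%N (w t.1) (t.2 i).
Let a (i : 'I_D.+1) : nat := nth 0%N (w j0) i.
Let L : nat := (\sum_j sumn (w j))%N.

(** The separators that do not kill the target word a; the letter of a at l is 0. *)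
Let ops : seq ('I_D.+1 * nat * nat) :=
  [seq o <- [seq (ic, d) | ic <- [seq (i, c) | i <- enum 'I_D.+1, c <- iota 0 L.+1],
                           d <- iota 0 L.+1]
     | (o.1.1 != l) && (o.1.2 + a o.1.1 != o.2)%N].

Let last_letter j : size (w j) = D.+1 -> nth 0%N (w j) D = 0%N.
Proof.
move=> wj; rewrite (set_nth_default 1%N) ?wj//.
by have := nth_last 1%N (w j); rewrite wj w_last.
Qed.

Let letter_le j i : (nth 0%N (w j) i <= L)%N.
Proof.
rewrite /L (bigD1 j)//=; apply: leq_trans (leq_addr _ _).
elim: (w j) i => [|x u IHu] [|i] //=; first exact: leq_addr.
exact: leq_trans (IHu i) (leq_addl _ _).
Qed.

(** If b t differs from a, then b t i - b t l differs from a i at some place i,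
because both words contain the letter 0; the parameters (i, b t l, b t i) then
belong to ops and give a vanishing separator. *)
Let separated (F : fieldType) (t : Tm) : size (w t.1) = D.+1 ->
  ~~ [forall i, b t i == a i] -> \prod_(o <- ops) separator p l b F o t = 0.
Proof.
move=> wt ba.
have [i bi] : exists i, b t i != (a i + b t l)%N.
  apply/existsP; apply: contraR ba => /existsPn ba.
  have {}ba i : b t i = (a i + b t l)%N by have := ba i; rewrite negbK => /eqP.
  have := ba (t.2^-1%g ord_max); rewrite {1}/b permKV last_letter// => /esym/eqP.
  rewrite addn_eq0 => /andP[_ /eqP b0].
  by apply/forallP => j; rewrite ba b0 addn0.
apply/eqP; rewrite prodf_seq_eq0; apply/hasP; exists (i, b t l, b t i).
  have bi' : (b t l + a i != b t i)%N by rewrite addnC eq_sym.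
  rewrite mem_filter; apply/andP; split.
    rewrite /= bi' andbT.
    by apply: contraNneq bi => ->; rewrite /a last_letter.
  apply/allpairsP; exists ((i, b t l), b t i); split; last by [].
    apply/allpairsP; exists (i, b t l); split; last by [].
      by rewrite mem_enum.
    by rewrite mem_iota ltnS letter_le.
  by rewrite mem_iota ltnS letter_le.
by rewrite /separator /= addnC subrr.
Qed.

Let B0 (F : fieldType) : {poly F} := \prod_(o <- ops) separator p l b F o (j0, 1%g).

Let target i : b (j0, 1%g) i = a i. Proof. by rewrite /b perm1. Qed.

Let B0_neq0 (F : fieldType) : B0 F != 0.
Proof.
rewrite /B0 prodf_seq_neq0; apply/allP => o; rewrite mem_filter => /andP[/andP[_ oa] _].
rewrite /= /separator !target {2}/a last_letter// addn0 subr_eq0.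
apply/eqP => /(congr1 (fun x : {poly F} => size x)); rewrite !size_polyXn => -[].
by move/(expnI (prime_gt1 p_prime)) => /eqP; apply/negP.
Qed.

Let St := [set s : {perm 'I_D.+1} | [forall i, nth 0%N (w j0) (s i) == nth 0%N (w j0) i]]%SET.

(** The terms that survive belong to the exponent of j0, as a word determines its
exponent, and to the permutations that fix the word. *)
Let term_sum_target (F : fieldType) (beta : 'I_k -> laurent F) (P : pred 'I_k)
    (g : {poly F}) (H : 'I_D.+1 -> {poly F}) : P j0 ->
  term_sum p b (fun t => (if P t.1 && (size (w t.1) == D.+1)
      then beta t.1 * poly_laurent (g ^+ r t.1) else 0)
      * poly_laurent (\prod_(o <- ops) separator p l b F o t)) H
  = (poly_laurent (g ^+ r j0 * B0 F) * beta j0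
     * poly_laurent (\prod_i H i ^+ (p ^ a i))) *+ #|St|.
Proof.
move=> Pj0; rewrite /term_sum.
rewrite -(pair_bigA _ (fun j s => (if P j && (size (w j) == D.+1)
      then beta j * poly_laurent (g ^+ r j) else 0)
      * poly_laurent (\prod_(o <- ops) separator p l b F o (j, s))
      * poly_laurent (\prod_i H i ^+ (p ^ b (j, s) i)))) /=.
rewrite (bigD1 j0)//= [X in _ + X]big1 ?addr0 => [|j jj0].
  rewrite Pj0 wj0 eqxx /= -sumr_const [RHS]big_mkcond /=.
  apply: eq_bigr => s _; rewrite inE; case: ifPn => [/'forall_eqP sa|ba].
    have bE i : b (j0, s) i = a i by exact: sa.
    have -> : \prod_(o <- ops) separator p l b F o (j0, s) = B0 F.
      by apply: eq_bigr => o _; rewrite /separator !target !bE.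
    have -> : \prod_i H i ^+ (p ^ b (j0, s) i) = \prod_i H i ^+ (p ^ a i).
      by apply: eq_bigr => i _; rewrite bE.
    rewrite (rmorphM (@poly_laurent F) (g ^+ r j0) (B0 F)); congr (_ * _).
    by rewrite -mulrA mulrC.
  by rewrite separated// rmorph0 mulr0 mul0r.
apply: big1 => s _; case: ifP => [/andP[_ /eqP wj]|_]; last by rewrite !mul0r.
rewrite separated ?rmorph0 ?mulr0 ?mul0r//; apply: contra jj0 => /'forall_eqP ba.
apply/eqP/r_inj; rewrite -(w_sum j) -(w_sum j0) (big_nth 0%N) big_mkord wj.
rewrite [RHS](big_nth 0%N) big_mkord wj0.
rewrite (reindex_inj (@perm_inj _ s)); apply: eq_bigr => i _.
by rewrite -[nth _ _ _]/(b (j, s) i) ba.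
Qed.

Let s : seq 'I_D.+1 := [seq i <- enum 'I_D.+1 | i != l].

Let uniq_ls : uniq (l :: s).
Proof. by rewrite /= mem_filter eqxx /= filter_uniq// enum_uniq. Qed.

Let mem_ls : l :: s =i 'I_D.+1.
Proof. by move=> i; rewrite in_cons mem_filter mem_enum !inE andbT orbN. Qed.

Let big_split_last (T : Type) (idx : T) (op : Monoid.com_law idx) (f : 'I_D.+1 -> T) :
  \big[op/idx]_i f i = op (f l) (\big[op/idx]_(i <- s) f i).
Proof. by rewrite (bigD1 l)//= /s big_filter big_enum_cond. Qed.

Lemma top_coefficient_words (J : {set 'I_k}) : j0 \in J ->
    (forall j, j \in J -> (size (w j) <= D.+1)%N) ->
  exists C : nat, forall (F : finFieldType) (charF : p \in [pchar F]) (m E : nat)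
    (beta : 'I_k -> laurent F) (g c : {poly F}),
    (C * E.+1 <= m)%N ->
    (#|F| ^ m)%:R <= `|\sum_(x : {poly_m F}) echar R charF
        (\sum_(j in J) beta j * poly_laurent ((g * val x + c) ^+ r j))| * (#|F| ^ E)%:R ->
  exists b : {poly F}, [/\ b != 0, (size b <= C * E.+1)%N &
    small (r j0 * m - C * E.+1) (poly_laurent (b * g ^+ r j0) * beta j0)].
Proof.
move=> j0J Jmax.
have ops_l : all (fun o => o.1.1 != l) ops.
  by apply/allP => o; rewrite mem_filter => /andP[/andP[]].
have [C1 sep] := card_trivial_tuples_separators p b ops_l.
have [C2 elim_s] := eliminate_variables a p_prime (subseq_uniq (subseq_cons s l) uniq_ls).
have [C3 sizeB0] := size_separators p l b ops (j0, 1%g).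
pose Z := (2 ^ size s)%N.
exists (C2 * (C1 * Z + C1 + 1) + C1 + C3 + 1)%N => F charF m E beta g c Cm large.
pose gam (t : Tm) : laurent F := if (t.1 \in J) && (size (w t.1) == D.+1)
  then beta t.1 * poly_laurent (g ^+ r t.1) else 0.
have polar (h : 'I_D.+1 -> {poly_m F}) (x : {poly_m F}) :
    adiff (l :: s) h (fun x : {poly_m F} => \sum_(j in J) beta j *
      poly_laurent ((g * val x + c) ^+ r j)) x = term_sum p b gam (fun i => val (h i)).
  move: uniq_ls mem_ls; move: (l :: s) => ls us sI; rewrite adiff_sum /term_sum.
  rewrite -(pair_bigA _ (fun j t => gam (j, t) *
    poly_laurent (\prod_i val (h i) ^+ (p ^ b (j, t) i)))) /=.
  rewrite big_mkcond; apply: eq_bigr => j _; rewrite adiff_scaled /gam /=.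
  case: ifP => [jJ|_] /=; last by rewrite big1 // => t _; rewrite mul0r.
  rewrite -[in LHS](w_sum j); have := Jmax j jJ; rewrite leq_eqVlt.
  case: eqP => [wj _|_ /= wj].
    rewrite (adiff_power_eq charF _ _ _ _ us sI wj) w_sum rmorphM rmorph_sum.
    by rewrite mulrA mulr_sumr.
  rewrite (adiff_power_lt charF _ _ _ _ us sI wj) rmorph0 mulr0.
  by rewrite big1 // => t _; rewrite mul0r.
have dense := weyl_trivial_tuples uniq_ls polar large; rewrite -/Z in dense.
have := sep F charF m m _ gam dense; set G := trivial_tuples _ _ _ _ _ _ => denseG.
pose x : laurent F := (poly_laurent (g ^+ r j0 * B0 F) * beta j0) *+ #|St|.
have G_small h : h \in G -> small (m - C1) (poly_laurent (monomial p s a h) * x).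
  move=> /trivial_tuplesP gh; apply: (psi_nondegenerate (charF := charF)) => y yM.
  rewrite -[RHS](gh y yM) term_sum_target //; congr (Defs.trFp _ (res _)).
  have -> : \prod_i put l y (fun i => val (h i)) i ^+ (p ^ a i)
      = y * monomial p s a h.
    rewrite big_split_last /put eqxx {1}/a last_letter// expn0 expr1.
    congr (_ * _); apply: eq_big_seq => i; rewrite mem_filter => /andP[il _].
    by rewrite (negbTE il).
  by rewrite /x !mulrnAr rmorphM; congr (_ *+ _); ring.
pose X := (C1 * Z + C1 + 1)%N; pose K := (C1 * (E * Z).+1)%N.
have KX : (C2 * K.+1 <= C2 * (X * E.+1))%N.
  by rewrite leq_mul2l; apply/orP; right; rewrite /K /X; nia.
have CE : ((C2 * X + C1 + C3 + 1) * E.+1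
    = C2 * (X * E.+1) + (C1 + C3 + 1) * E + (C1 + C3 + 1))%N by ring.
rewrite -/X in Cm *; rewrite -/K in denseG.
have [||b1 [b1n0 b1s b1small]] := elim_s F charF m _ _ G x G_small denseG.
- by move: CE KX Cm; lia.
- by move: CE KX Cm; lia.
exists (b1 * B0 F); split.
- by rewrite mulf_neq0// B0_neq0.
- apply: leq_trans (size_polyMleq _ _) _; have := sizeB0 F; rewrite -/(B0 F).
  by move: (size b1) (size (B0 F)) b1s CE KX Cm => u v; lia.
have pSt := stabilizer_coprime p_prime wj0 (w_lt j0).
apply: (small_mulrn charF pSt); rewrite -/St.
have -> : (poly_laurent (b1 * B0 F * g ^+ r j0) * beta j0) *+ #|St|
    = poly_laurent b1 * x.
  by rewrite /x mulrnAr !rmorphM; congr (_ *+ _); ring.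
apply: smallW b1small.
have rE : (r j0 = 1 + \sum_(i <- s) p ^ a i)%N.
  rewrite -(w_sum j0) (big_nth 0%N) big_mkord wj0 big_split_last.
  by rewrite last_letter.
rewrite rE mulnDl mul1n; move: CE KX Cm.
by move: ((\sum_(i <- s) p ^ a i) * m)%N => u; lia.
Qed.

End Words.

End TopCoefficient.

(** * Removal of exponents *)

Section Descent.
Variables (R : realType) (p k : nat) (r : 'I_k -> nat) (w : 'I_k -> seq nat).
Hypothesis p_prime : prime p.
Hypothesis w_sum : forall j, (\sum_(a <- w j) p ^ a)%N = r j.
Hypothesis w_lt : forall j v, (count_mem v (w j) < p)%N.
Hypothesis w_last : forall j, last 1%N (w j) = 0%N.
Hypothesis r_inj : injective r.
Hypothesis r_gt0 : forall j, (0 < r j)%N.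

Definition weyl_sum (F : finFieldType) (charF : p \in [pchar F]) (m : nat)
    (J : {set 'I_k}) (beta : 'I_k -> laurent F) (g c : {poly F}) : R[i] :=
  \sum_(x : {poly_m F}) echar R charF
    (\sum_(j in J) beta j * poly_laurent ((g * val x + c) ^+ r j)).

Lemma top_coefficient (J : {set 'I_k}) (j0 : 'I_k) : j0 \in J ->
    (forall j, j \in J -> (size (w j) <= size (w j0))%N) ->
  exists C : nat, forall (F : finFieldType) (charF : p \in [pchar F]) (m E : nat)
    (beta : 'I_k -> laurent F) (g c : {poly F}),
    (C * E.+1 <= m)%N ->
    (#|F| ^ m)%:R <= `|weyl_sum charF m J beta g c| * (#|F| ^ E)%:R ->
  exists b : {poly F}, [/\ b != 0, (size b <= C * E.+1)%N &
    small (r j0 * m - C * E.+1) (poly_laurent (b * g ^+ r j0) * beta j0)].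
Proof.
move=> j0J; case wj0 : (size (w j0)) => [|D]; last first.
  exact: (top_coefficient_words R p_prime w_sum w_lt w_last r_inj wj0 j0J).
by have := w_last j0; rewrite (size0nil wj0).
Qed.

(** This is x^s - y^s = (x - y) (x^(s-1) + ... + y^(s-1)). *)
Lemma power_difference (F : finFieldType) (g c B x0 z : {poly F}) (n m m' s : nat) :
    (0 < s)%N -> (size g + m <= n.+1)%N -> (size c <= n)%N -> (size x0 <= m)%N ->
    (size B + m' <= m.+1)%N -> (size z <= m')%N ->
  exists2 y : {poly F}, (size y <= size g + m' + s.-1 * n)%N &
    (g * (x0 + B * z) + c) ^+ s = (g * x0 + c) ^+ s + B * y.
Proof.
move=> s0 gm cn x0m Bm zm; set u := g * (x0 + B * z) + c; set v := g * x0 + c.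
have size_le (x : {poly F}) : (size x <= m)%N -> (size (g * x + c)%R <= n)%N.
  move=> xm; apply: leq_trans (size_polyD _ _) _; rewrite geq_max cn andbT.
  by apply: leq_trans (size_polyMleq _ _) _; lia.
have sv : (size v <= n)%N by exact: size_le.
have su : (size u <= n)%N.
  apply: size_le; apply: leq_trans (size_polyD _ _) _; rewrite geq_max x0m /=.
  by apply: leq_trans (size_polyMleq _ _) _; lia.
pose W : {poly F} := \sum_(i < s) u ^+ (s.-1 - i) * v ^+ i.
exists (g * z * W); last first.
  apply/eqP; rewrite addrC -subr_eq subrXX.
  have -> : u - v = B * (g * z) by rewrite /u /v; ring.
  by rewrite -!mulrA; apply/eqP; congr (_ * (_ * (_ * _))); exact: eq_bigr.
apply: leq_trans (size_polyMleq _ _) _.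
have sgz : (size (g * z)%R <= size g + m')%N.
  by apply: leq_trans (size_polyMleq _ _) _; lia.
have ssum : (size W <= (s.-1 * n).+1)%N.
  apply: leq_trans (size_sum _ _ _) _; apply/bigmax_leqP => i _.
  apply: leq_trans (size_polyMleq _ _) _.
  have := @size_polyX_exp F u (s.-1 - i) n (leqW su).
  have := @size_polyX_exp F v i n (leqW sv); have := ltn_ord i.
  have : ((s.-1 - i) * n + i * n <= s.-1 * n)%N.
    by rewrite -mulnDl leq_mul2r; have := ltn_ord i; lia.
  by move: (size (u ^+ _)) (size (v ^+ _)) => U T; lia.
by rewrite -subn1 leq_subLR add1n -addnS; exact: leq_add.
Qed.

(** On the progression x0 + B z the phase of the exponent j changes by B beta_j y, where
the degree of y is too small for it to be seen by the character. Some progression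
has at least the average size of the sum. *)
Lemma remove_exponent (F : finFieldType) (charF : p \in [pchar F]) (J : {set 'I_k})
    (beta : 'I_k -> laurent F) (g c B : {poly F}) (n m m' E : nat) j : j \in J ->
    (size g + m <= n.+1)%N -> (size c <= n)%N -> (size B + m' <= m.+1)%N ->
    small (size g + m' + (r j).-1 * n) (poly_laurent B * beta j) ->
    (#|F| ^ m)%:R <= `|weyl_sum charF m J beta g c| * (#|F| ^ E)%:R ->
  exists x0 : {poly_m F},
    (#|F| ^ m')%:R <= `|weyl_sum charF m' (J :\ j)%SET beta (g * B) (g * val x0 + c)|
                      * (#|F| ^ E)%:R.
Proof.
move=> jJ gm cn Bm smallB large; set q := #|F| in large *.
pose ph (x : {poly F}) := echar R charF
    (\sum_(j in J) beta j * poly_laurent ((g * x + c) ^+ r j)).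
pose T (x : {poly_m F}) := `|weyl_sum charF m' (J :\ j)%SET beta (g * B) (g * val x + c)|.
have q0 : (0 < q)%N by rewrite (ltnW (card_field_gt1 F)).
have TE (x : {poly_m F}) : `|\sum_(z : {poly_m' F}) ph (val x + B * val z)| = T x.
  rewrite /T /weyl_sum.
  have -> : \sum_(z : {poly_m' F}) ph (val x + B * val z)
      = echar R charF (beta j * poly_laurent ((g * val x + c) ^+ r j)) *
        weyl_sum charF m' (J :\ j)%SET beta (g * B) (g * val x + c).
    rewrite mulr_sumr; apply: eq_bigr => z _; rewrite /ph.
    rewrite (big_setD1 j)//= echarD; congr (_ * _); last first.
      congr echar; apply: eq_bigr => i _.
      by rewrite (_ : g * (val x + _) + c = g * B * val z + (g * val x + c))//; ring.
    have [y sy ->] := power_difference (r_gt0 j) gm cn (size_npoly x) Bm (size_npoly z).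
    rewrite rmorphD mulrDr echarD [X in _ * X](_ : _ = 1) ?mulr1//.
    rewrite /echar.
    have -> : Defs.res (beta j * poly_laurent (B * y)) = 0.
      have -> : beta j * poly_laurent (B * y) = poly_laurent y * (poly_laurent B * beta j).
        by rewrite (rmorphM _ B y); ring.
      rewrite /Defs.res.
      have [->|y0] := eqVneq y 0; first by rewrite rmorph0 mul0r.
      have sy0 : (0 < size y)%N by rewrite size_poly_gt0.
      have sy' : (size y <= (size y).-1.+1)%N by rewrite prednK.
      by apply: (small_polyM sy' smallB (i := 0)); lia.
    by rewrite -[trFp _ _]/(psi charF 0) psi0 /= mulr0 cos0 sin0.
  by rewrite normrM echar_norm mul1r.
apply: contrapT => /forallNP small_sums.
have lt x : T x * (q ^ E)%:R < (q ^ m')%:R.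
  have := small_sums x; rewrite -/(T x) => /negP; rewrite -real_ltNge ?realM ?realn//.
  by rewrite ger0_real ?normr_ge0.
have bound : `|weyl_sum charF m J beta g c| * (q ^ m')%:R <= \sum_x T x.
  rewrite -[(q ^ m')%:R]ger0_norm ?ler0n// -normrM.
  have -> : weyl_sum charF m J beta g c * (q ^ m')%:R
     = \sum_(x : {poly_m F}) \sum_(z : {poly_m' F}) ph (val x + B * val z).
    rewrite exchange_big /= mulr_natr -card_npoly -sumr_const.
    apply: eq_bigr => z _.
    have sBz : (size (B * val z)%R <= m)%N.
      apply: leq_trans (size_polyMleq _ _) _.
      rewrite -subn1 leq_subLR add1n; apply: leq_trans Bm; rewrite leq_add2l.
      exact: size_npoly.
    rewrite /weyl_sum (reindex_inj (addIr (npolyp m (B * val z)))) /=.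
    apply: eq_bigr => x _; rewrite /ph.
    by rewrite npolypK.
  apply: le_trans (ler_norm_sum _ _ _) _.
  by apply: ler_sum => x _; rewrite TE.
have : (\sum_x T x) * (q ^ E)%:R < (q ^ m)%:R * (q ^ m')%:R.
  rewrite mulr_suml -natrM -(card_npoly F m) natrM mulr_natl -sumr_const.
  apply: ltr_sum => [|x _]; last exact: lt.
  by apply/hasP; exists 0 => //; rewrite mem_index_enum.
apply/negP; rewrite -real_leNgt ?realn//; last first.
  by rewrite ger0_real// mulr_ge0// sumr_ge0// => x _; exact: normr_ge0.
apply: le_trans (ler_wpM2r (ler0n _ _) bound).
by rewrite [X in _ <= X]mulrAC ler_wpM2r// ler0n.
Qed.

(** Induction on the set of exponents: as long as i does not have the largest digit
sum, remove one that has. The sums that occur are over x of degree less than m, for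
f = g x + c of degree less than n, with n - m = O(E + 1). *)
Lemma coefficient_approximation (i : 'I_k) (J : {set 'I_k}) (C0 : nat) : i \in J ->
  exists C : nat, forall (F : finFieldType) (charF : p \in [pchar F]) (n m E : nat)
    (beta : 'I_k -> laurent F) (g c : {poly F}),
    (0 < size g)%N -> (size g + m <= n.+1)%N -> (size c <= n)%N ->
    (n <= m + C0 * E.+1)%N -> (C * E.+1 <= n)%N ->
    (#|F| ^ m)%:R <= `|weyl_sum charF m J beta g c| * (#|F| ^ E)%:R ->
  exists B : {poly F}, [/\ B != 0, (size B <= C * E.+1)%N &
    small (r i * n - C * E.+1) (poly_laurent B * beta i)].
Proof.
have [d] := ubnP #|J|; elim: d J C0 => // d IHd J C0 Jd iJ.
pose j := [arg max_(j > i in J) size (w j)].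
have [jJ jmax] : j \in J /\ forall j', j' \in J -> (size (w j') <= size (w j))%N.
  by rewrite /j; case: arg_maxnP => // j' j'J j'max; split.
have [C topC] := top_coefficient jJ jmax.
(* With the progression taken into account, B = b * g ^+ r j approximates beta j. *)
have denominator (F : finFieldType) (charF : p \in [pchar F]) (n m E : nat)
    (beta : 'I_k -> laurent F) (g c : {poly F}) :
    (0 < size g)%N -> (size g + m <= n.+1)%N ->
    (n <= m + C0 * E.+1)%N -> ((C + C0) * E.+1 <= n)%N ->
    (#|F| ^ m)%:R <= `|weyl_sum charF m J beta g c| * (#|F| ^ E)%:R ->
  exists B : {poly F}, [/\ B != 0, (size B <= (C + r j * C0) * E.+1)%N &
    small (r j * n - (C + r j * C0) * E.+1) (poly_laurent B * beta j)].
  move=> g0 gm nm Cn large.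
  have [|b [b0 sb smallb]] := topC F charF m E beta g c _ large.
    by move: Cn nm; rewrite mulnDl; lia.
  exists (b * g ^+ r j); split.
  - by rewrite mulf_neq0// expf_neq0// -size_poly_gt0.
  - have sg : (size g <= (C0 * E.+1).+1)%N by lia.
    have sgr := size_polyX_exp (r j) sg.
    apply: leq_trans (size_polyMleq _ _) _; rewrite mulnDl -mulnA.
    by rewrite -subn1 leq_subLR add1n -addnS; exact: leq_add.
  - apply: smallW smallb.
    have : (r j * n <= r j * m + r j * (C0 * E.+1))%N by rewrite -mulnDr leq_mul2l nm orbT.
    by rewrite mulnDl -mulnA; lia.
have [ij|ij] := eqVneq i j.
  exists (C + C0 + r j * C0)%N => F charF n m E beta g c g0 gm _ nm Cn large.
  have [|B [B0 sB smallB]] := denominator F charF n m E beta g c g0 gm nm _ large.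
    by apply: leq_trans Cn; rewrite leq_mul2r leq_addr orbT.
  have le : ((C + r j * C0) * E.+1 <= (C + C0 + r j * C0) * E.+1)%N.
    by rewrite leq_mul2r; apply/orP; right; lia.
  exists B; rewrite ij; split=> //; first exact: leq_trans le.
  by apply: smallW smallB; lia.
pose C' := (C + r j * C0 + C0 + 1)%N.
have [||C1 IH] := IHd (J :\ j)%SET (C0 + C')%N.
- by move: Jd; rewrite (cardsD1 j) jJ.
- by rewrite !inE ij.
exists (C1 + C + C0 + C')%N => F charF n m E beta g c g0 gm cn nm Cn large.
have [|B [B0 sB smallB]] := denominator F charF n m E beta g c g0 gm nm _ large.
  by apply: leq_trans Cn; rewrite leq_mul2r; apply/orP; right; lia.
pose m' := (m - C' * E.+1)%N.
have Bs : (0 < size B)%N by rewrite size_poly_gt0.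
have C'E : (C' * E.+1 = (C + r j * C0) * E.+1 + C0 * E.+1 + E.+1)%N.
  by rewrite /C' !mulnDl mul1n.
have CnE : ((C1 + C + C0 + C') * E.+1
    = C1 * E.+1 + C * E.+1 + C0 * E.+1 + C' * E.+1)%N by rewrite !mulnDl.
have Bm : (size B + m' <= m.+1)%N by rewrite /m'; lia.
have [|x0 large'] := remove_exponent (E := E) jJ gm cn Bm _ large.
  apply: smallW smallB.
  have : (r j * n = (r j).-1 * n + n)%N by rewrite -{1}[r j]prednK ?mulSn 1?addnC// r_gt0.
  by rewrite /m'; lia.
have sgx : (size (g * val x0 + c)%R <= n)%N.
  apply: leq_trans (size_polyD _ _) _; rewrite geq_max cn andbT.
  apply: leq_trans (size_polyMleq _ _) _; rewrite -subn1 leq_subLR add1n.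
  by apply: leq_trans gm; rewrite leq_add2l size_npoly.
have sgB : size (g * B) = (size g + size B).-1.
  by rewrite size_mul// -size_poly_gt0.
have [||||B' [B'0 sB' smallB']] :=
  IH F charF n m' E beta (g * B) (g * val x0 + c) _ _ sgx _ _ large'.
- by rewrite sgB; lia.
- by rewrite sgB; lia.
- by rewrite mulnDl /m'; lia.
- by lia.
exists B'; split=> //; first by lia.
by apply: smallW smallB'; lia.
Qed.

End Descent.

(** * The bound *)

Theorem corollaryC2 (R : realType) (p s q k : nat) (r : 'I_k -> nat)
    (p_prime : prime p) (s_gt0 : (0 < s)%N) (qE : q = (p ^ s)%N)
    (r_inj : injective r) (r_gt0 : forall j, (0 < r j)%N)
    (r_coprime : forall j, coprime (r j) p) :
  exists c A : R, [/\ 0 < c, 0 < A &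
    forall (F : finFieldType) (charF : p \in [pchar F]) (cardF : #|F| = q)
           (n : nat) (n_gt0 : (0 < n)%N)
           (beta : 'I_k -> laurent F) (betaT : forall j, unitT (beta j))
           (i : 'I_k),
      let Delta : \bar R :=
        er_map intr (ord (beta i) + ((r i * n)%N%:Z)%:E)%E in
      (Delta < (n%:R / 2)%:E)%E ->
      ((ComplexField.Normc.normc
          (\sum_(f : {poly_n F})
             echar R charF (\sum_j beta j * poly_laurent (val f) ^+ r j)))%:E
        <= A%:E * epow q%:R (n%:R%:E - c%:E * Delta))%E].
Proof.
have /all_sig[w wP] j : {u : seq nat | [/\ (\sum_(a <- u) p ^ a = r j)%N,
    forall v, (count_mem v u < p)%N & last 1%N u = 0%N]}.
  have [u [u1 u2 u3]] := cid (digit_word p_prime (r j)).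
  by exists u; split=> //; exact: u3.
have w_sum j : (\sum_(a <- w j) p ^ a)%N = r j by have [] := wP j.
have w_lt j v : (count_mem v (w j) < p)%N by have [] := wP j.
have w_last j : last 1%N (w j) = 0%N by have [] := wP j.
have /all_sig[Ci CiP] i := cid (coefficient_approximation R p_prime w_sum w_lt
  w_last r_inj r_gt0 0 (finset.in_setT i)).
pose C := (\sum_i Ci i).+1.
have q1 : (1 < q)%N by rewrite qE -(expn0 p) ltn_exp2l// prime_gt1.
have q0 : (0 < q)%N by exact: ltnW.
(* With E = D / 4C one has C (E + 1) <= D / 4 + C < D as soon as D >= 2C. *)
pose c : R := (4 * C)%:R^-1.
have c0 : 0 < c by rewrite invr_gt0 ltr0n.
exists c, q%:R; split; [exact: c0|by rewrite ltr0n|].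
move=> F charF cardF n n_gt0 beta _ i /=.
set S := \sum_f _; set N := ComplexField.Normc.normc S.
have [b0|b0] := eqVneq (beta i) 0.
  rewrite /ord b0 eqxx /= => _.
  by rewrite gt0_muleNy ?lte_fin//= gt0_muley ?lte_fin ?ltr0n// leey.
have [J [bJ bmax]] := lead_ex b0.
rewrite (ord_laurentE bJ bmax) /=; set d : int := J + (r i * n)%N%:Z.
rewrite lte_fin => dn; rewrite -EFinM lee_fin.
have NE : (N%:C)%C = `|S| by [].
have qX (e : nat) : ((q%:R ^+ e : R)%:C)%C = (q ^ e)%:R.
  by rewrite rmorphXn rmorph_nat -natrX.
have Nn : N <= q%:R ^+ n.
  rewrite -lecR NE qX; apply: le_trans (ler_norm_sum _ _ _) _.
  under eq_bigr do rewrite echar_norm.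
  by rewrite sumr_const card_npoly cardF.
have powE (x : R) : q%:R * q%:R `^ x = q%:R `^ (1 + x).
  by rewrite powRD ?powRr1// pnatr_eq0 -lt0n q0 implybT.
rewrite powE.
have mono (x y : R) : x <= y -> q%:R `^ x <= q%:R `^ y.
  by apply: ler_powR; rewrite ler1n.
have [dC|dC] := ltP d (2 * C)%N%:Z.
  apply: le_trans Nn _; rewrite -powR_mulrn//; apply: mono.
  rewrite addrCA lerDl subr_ge0 /c ler_pdivrMl ?ltr0n// mulr1.
  by rewrite -[(4 * C)%:R]/((4 * C)%N%:Z%:~R) ler_int; lia.
have [D dD] : exists D : nat, d = D%:Z by exists (absz d); lia.
rewrite dD in dC dn *; rewrite -[D%:Z%:~R]/(D%:R : R) in dn *.
have {}dn : (D * 2 < n)%N.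
  by rewrite -(ltr_nat R) natrM -ltr_pdivlMr// ltr0n.
pose E := (D %/ (4 * C))%N.
have DE : (D < E.+1 * (4 * C))%N by rewrite ltn_ceil// muln_gt0.
have DE' : (E * (4 * C) <= D)%N by exact: leq_trunc_div.
have CE : (C * E.+1 < D)%N.
  have -> : (C * E.+1 = E * C + C)%N by ring.
  have : (E * (4 * C) = 4 * (E * C))%N by ring.
  by move: DE' dC; rewrite lez_nat; lia.
have [large|small_sum] := leP (q%:R ^+ n) (N * q%:R ^+ E); last first.
  have qE0 : 0 < q%:R ^+ E :> R by rewrite exprn_gt0// ltr0n.
  rewrite -(ler_pM2r qE0); apply: le_trans (ltW small_sum) _.
  rewrite -!powR_mulrn// -powRD; last by rewrite pnatr_eq0 -lt0n q0 implybT.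
  apply: mono; rewrite -subr_ge0.
  have -> : 1 + (n%:R - c * D%:R) + E%:R - n%:R = E.+1%:R - c * D%:R :> R.
    by rewrite -natr1; ring.
  rewrite subr_ge0 /c mulrC ler_pdivrMr ?ltr0n// -natrM ler_nat.
  exact: ltnW.
exfalso.
have CiC : (Ci i <= C)%N by rewrite /C (bigD1 i)//=; lia.
have CiE : (Ci i * E.+1 <= C * E.+1)%N by rewrite leq_mul2r CiC orbT.
have [||||||B [B0 sB smallB]] := CiP i F charF n n E beta 1 0.
- by rewrite size_poly1.
- by rewrite size_poly1.
- by rewrite size_poly0.
- by rewrite mul0n addn0.
- by lia.
- rewrite cardF -!qX -lecR in large *.
  move: large; rewrite rmorphM /= NE; congr (_ <= `|_| * _).
  apply: eq_bigr => f _; congr echar.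
  by apply: eq_big => [j|j _]; rewrite ?finset.in_setT// mul1r addr0 rmorphXn.
have JN : J = Negz (r i * n - D.+1)%N.
  have : (n <= r i * n)%N by rewrite leq_pmull// r_gt0.
  by move: dD; rewrite /d; lia.
have rn : (n <= r i * n)%N by rewrite leq_pmull// r_gt0.
have Bs : (0 < size B)%N by rewrite size_poly_gt0.
have bsmall : small (r i * n - D.+1) (beta i).
  by move=> j jlt; apply: bmax; rewrite JN; lia.
have dB : ((size B).-1 <= r i * n - D.+1)%N by lia.
have := coef_lead_polyM bsmall dB; rewrite smallB; last by lia.
by rewrite -JN => /esym/eqP; rewrite mulf_eq0 lead_coef_eq0 (negbTE B0) (negbTE bJ).
Qed.
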